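(* Fix $L>4\pi$, and let $k_L$, $c(k)$, $A(k)$, $\phi_k$, $\mathcal{L}_k$ and $M_k$ be as defined in the context. For $k\in(0,k_L)$ let $$\Phi:=\left\langle\mathcal{L}_k\left(\frac{\partial\phi_k}{\partial k}\right),\frac{\partial\phi_k}{\partial k}\right\rangle .$$ Then $$\Phi=-\left(M_k'(\phi_k),\frac{\partial\phi_k}{\partial k}\right)_{L^2_{per}}<0 .$$
   Context: $(\cdot,\cdot)_{L^2_{per}}$ is the inner product of $L^2_{per}([0,L])$ and $\langle\cdot,\cdot\rangle$ is the duality pairing between $H^1_{per}([0,L])$ and its dual $H^{-1}_{per}([0,L])$. $K(k)=\int_0^{\pi/2}(1-k^2\sin^2\theta)^{-1/2}d\theta$ is the complete elliptic integral of the first kind and $\mathrm{cn}(\cdot,k)$ is the Jacobi cnoidal elliptic function with modulus $k\in(0,1)$ (parameter $m=k^2$). The function $g(k)=64K^2(k)\sqrt{k^4-k^2+1}$ is strictly increasing on $(0,1)$ with $g(0)=16\pi^2$ and $g(k)\to+\infty$ as $k\to1$; for $L>4\pi$, $k_L\in(0,1)$ denotes the unique number with $g(k_L)=L^2$. For $k\in(0,k_L)$ put $$\tilde m(k)=L^2-64K^2(k)\sqrt{k^4-k^2+1},\qquad c(k)=\frac{L^2}{\tilde m(k)},$$ $$A(k)=\frac{-204800K^6(k)}{27\,\tilde m^3(k)}\left(\sqrt{k^4-k^2+1}-(2k^2-1)\right)^2\left(2\sqrt{k^4-k^2+1}+(2k^2-1)\right),$$ $$\phi_k(x)=\left[\frac{5}{12}\left(\frac{L^2-64(2k^2-1)K^2(k)}{\tilde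 m(k)}-1\right)+\frac{80k^2K^2(k)}{\tilde m(k)}\,\mathrm{cn}^2\!\left(\frac{2K(k)}{L}x,k\right)\right]^2 .$$ The map $k\mapsto\phi_k$ is smooth into the smooth $L$-periodic functions, and $\phi_k$ solves $-c\phi''+(c-1)\phi-\phi^{3/2}+A=0$ with $c=c(k)$, $A=A(k)$. The linearized operator is $$\mathcal{L}_k f=-c(k)f''+(c(k)-1)f-\frac32\phi_k^{1/2}f .$$ With $Q(u)=\frac12\int_0^L(u^2+u_x^2)\,dx$ and $V(u)=\int_0^L u\,dx$, define on $H^1_{per}([0,L])$ $$M_k(u)=\frac{\partial c}{\partial k}(k)\,Q(u)+\frac{\partial A}{\partial k}(k)\,V(u);$$ $M_k'$ denotes its Fréchet derivative, so that $M_k'(\phi_k)=\frac{\partial c}{\partial k}(\phi_k-\phi_k'')+\frac{\partial A}{\partial k}$, where $'$ on $\phi_k$ is the $x$-derivative. *)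

(* Defs.v *)
From mathcomp Require Import all_boot all_order all_algebra all_classical all_reals.
From mathcomp Require Import topology normedtype measure measurable_realfun lebesgue_measure lebesgue_integral.
From mathcomp Require Import Rstruct Rstruct_topology.
From Stdlib Require Import Reals Lra ClassicalEpsilon.
From Coquelicot Require Import Coquelicot.
Local Open Scope R_scope.

(* Real numbers are those of Stdlib (with its [sin], [cos], [PI], [sqrt]),
   derivatives and the elliptic integrals are Coquelicot's [Derive] and [RInt];
   the spaces L^2_per([0,L]) and H^1_per([0,L]) use the Lebesgue measure of
   MathComp-Analysis, for which Stdlib's [R] is an instance of [realType]. *)

(* Incomplete elliptic integral of the first kind, with modulus k. *)
Definition ellF (k p : R) : R :=
  RInt (fun t => / sqrt (1 - k ^ 2 * sin t ^ 2)) 0 p.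

Definition ellK (k : R) : R := ellF k (PI / 2).

(* The amplitude am(x,k) is the inverse of p |-> ellF k p, which is an
   increasing bijection of R when 0 < k < 1. *)
Definition am (x k : R) : R := epsilon (inhabits 0) (fun p => ellF k p = x).

Definition cn (x k : R) : R := cos (am x k).

Definition intL (L : R) (f : R -> R) : R :=
  Rintegral (@lebesgue_measure R) (`[0, L])%classic f.

Definition integrable_per (L : R) (f : R -> R) : Prop :=
  integrable (@lebesgue_measure R) (`[0, L])%classic (EFin \o f).

Definition L2per (L : R) (f : R -> R) : Prop :=
  measurable_fun (T := measurableTypeR R) (U := measurableTypeR R)
    (`[0, L])%classic f /\
  integrable_per L (fun x => f x ^ 2).

Definition L2inner (L : R) (f g : R -> R) : R :=
  intL L (fun x => f x * g x).

(* Pairing of H^{-1}_per with H^1_per: through L^2_per -> H^{-1}_per, an element u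
   of L^2_per is the functional v |-> (u,v). Only such u are needed, since
   the linearized operator is applied to smooth functions. *)
Definition pairing (L : R) (u v : R -> R) : R := L2inner L u v.

Definition smooth_per (L : R) (u : R -> R) : Prop :=
  (forall n x, ex_derive_n u n x) /\ (forall x, u (x + L) = u x).

(* u belongs to H^1_per([0,L]), with weak derivative v. As v is determined by u
   almost everywhere, an element of H^1_per is handled below as such a pair. *)
Definition H1per (L : R) (u v : R -> R) : Prop :=
  [/\ L2per L u, L2per L v &
    forall psi, smooth_per L psi ->
      L2inner L u (Derive psi) = - L2inner L v psi].

Definition H1norm (L : R) (u v : R -> R) : R :=
  sqrt (L2inner L u u + L2inner L v v).

(* The function G of L^2_per represents, for the inner product of L^2_per, the
   Frechet derivative at u (with weak derivative v) of the functional F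
   on H^1_per. *)
Definition is_L2_derivative (L : R) (F : (R -> R) -> (R -> R) -> R)
    (u v G : R -> R) : Prop :=
  L2per L G /\
  forall eps, 0 < eps -> exists2 del, 0 < del &
    forall h hx, H1per L h hx -> H1norm L h hx < del ->
      Rabs (F (fun x => u x + h x) (fun x => v x + hx x) - F u v
            - L2inner L G h) <= eps * H1norm L h hx.

Definition L2_derivative (L : R) (F : (R -> R) -> (R -> R) -> R)
    (u v : R -> R) : R -> R :=
  epsilon (inhabits (fun _ => 0)) (is_L2_derivative L F u v).

Lemma meas_per (L : R) : measurable ((`[0, L])%classic : set (measurableTypeR R)).
Proof. exact: measurable_itv. Qed.

Lemma integrable_perD L f h : integrable_per L f -> integrable_per L h ->
  integrable_per L (fun x => f x + h x).
Proof. move=> If Ih; exact: (integrableD (meas_per L) If Ih). Qed.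

Lemma integrable_perZ L a f : integrable_per L f ->
  integrable_per L (fun x => a * f x).
Proof. move=> If; exact: (integrableZl (meas_per L) a If). Qed.

Lemma intLD L f h : integrable_per L f -> integrable_per L h ->
  intL L (fun x => f x + h x) = intL L f + intL L h.
Proof. move=> If Ih; exact: (RintegralD (meas_per L) If Ih). Qed.

Lemma intLZ L a f : integrable_per L f ->
  intL L (fun x => a * f x) = a * intL L f.
Proof. move=> If; exact: (RintegralZl a (meas_per L) If). Qed.

Lemma L2_mul L f h : L2per L f -> L2per L h ->
  integrable_per L (fun x => f x * h x).
Proof.
move=> [mf If] [mh Ih].
have I2 := integrable_perD _ _ _ If Ih.
apply: (le_integrable (meas_per L) _ _ I2).
- apply/measurable_EFinP. exact: measurable_funM mf mh.
- move=> x _ /=; rewrite lee_fin.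
  change (is_true (Num.le (Rabs (f x * h x)) (Rabs (f x ^ 2 + h x ^ 2)))).
  apply/RleP; rewrite (Rabs_pos_eq (_ + _)); last nra.
  apply: Rabs_le; nra.
Qed.

Lemma cont_int L f : (forall x, continuity_pt f x) -> integrable_per L f.
Proof.
move=> cf; apply: (@continuous_compact_integrable R).
  exact: segment_compact.
apply: continuous_subspaceT => x; exact/continuity_pt_cvg.
Qed.

Lemma cont_L2 L f : (forall x, continuity_pt f x) -> L2per L f.
Proof.
move=> cf; split.
- have /integrableP[+ _] := cont_int L f cf.
  by move/measurable_EFinP.
- apply: cont_int => x. 
  apply: continuity_pt_ext (continuity_pt_mult _ _ x (cf x) (cf x)) => y; rewrite /mult_fct; ring.
Qed.

Lemma intL_ge0 L f : (forall x, 0 <= f x) -> 0 <= intL L f.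
Proof. by move=> f0; apply/RleP; apply: Rintegral_ge0 => x _; apply/RleP. Qed.

Lemma intL_ext L f h : (forall x, f x = h x) -> intL L f = intL L h.
Proof. by move=> fh; congr intL; apply/funext. Qed.

Lemma smooth_cont L u : smooth_per L u -> forall x, continuity_pt u x.
Proof.
move=> [su _] x; apply: derivable_continuous_pt.
have H : ex_derive u x := su (S O) x.
exact: ex_derive_Reals_0 _ _ H.
Qed.

Lemma smooth_Derive L u : smooth_per L u -> smooth_per L (Derive u).
Proof.
move=> [su pu]; split=> [n x|x].
  have := su (S n) x; case: n => [|n] //= H.
  apply: ex_derive_ext H => t.
  rewrite -[LHS]/(Derive_n u (S n) t) -addn1.
  by rewrite -(Derive_n_comp u n 1).
rewrite -(Derive_ext (fun y => u (y + L)) u x pu) /Derive.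
by congr (real _); apply: Lim_ext => y; congr (_ / _); congr (u _ - u _); ring.
Qed.

Lemma L2_scale L t f : L2per L f -> L2per L (fun x => t * f x).
Proof.
move=> Lf; split; first by case: Lf => mf _; exact: measurable_funM (measurable_cst _) mf.
have := integrable_perZ _ (t * t) _ (L2_mul _ _ _ Lf Lf).
by congr integrable_per; apply/funext => x; ring.
Qed.

Lemma L2inner_scale L t f h : L2per L f -> L2per L h ->
  L2inner L f (fun x => t * h x) = t * L2inner L f h.
Proof.
move=> Lf Lh; rewrite /L2inner -intLZ; last exact: L2_mul.
by apply: intL_ext => x; ring.
Qed.

(* As a functional on H^1_per, the derivative is unique. *)
Lemma L2_derivative_unique L F u v G1 G2 h hx :
  is_L2_derivative L F u v G1 -> is_L2_derivative L F u v G2 ->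
  H1per L h hx -> L2inner L G1 h = L2inner L G2 h.
Proof.
move=> [LG1 D1] [LG2 D2] [Lh Lhx wd].
set N := H1norm L h hx; have N0 : 0 <= N by exact: sqrt_pos.
set d := L2inner L G1 h - L2inner L G2 h.
have H eps : 0 < eps -> Rabs d <= 2 * eps * N.
  move=> eps0; have [d1 d10 {}D1] := D1 _ eps0; have [d2 d20 {}D2] := D2 _ eps0.
  set del := Rmin d1 d2; have del0 : 0 < del by exact: Rmin_pos.
  set t := del / (N + 1); have t0 : 0 < t by apply: Rdiv_lt_0_compat; lra.
  have tN : t * N < del.
    have -> : del = t * (N + 1) by rewrite /t; field; lra.
    nra.
  pose th x := t * h x; pose thx x := t * hx x.
  have Hth : H1per L th thx.
    split; [exact: L2_scale|exact: L2_scale|] => psi spsi.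
    have Lpsi := cont_L2 L _ (smooth_cont _ _ spsi).
    have Lpsi' := cont_L2 L _ (smooth_cont _ _ (smooth_Derive _ _ spsi)).
    have sym f f' : L2inner L f f' = L2inner L f' f.
      by apply: intL_ext => x; ring.
    rewrite (sym th) (sym thx) !L2inner_scale // (sym _ h) (sym _ hx) wd //; ring.
  have nth : H1norm L th thx = t * N.
    have sq f : L2per L f -> L2inner L (fun x => t * f x) (fun x => t * f x)
        = t ^ 2 * L2inner L f f.
      move=> Lf; rewrite L2inner_scale //; last exact: L2_scale.
      rewrite /L2inner -!intLZ; try exact: L2_mul.
        by apply: intL_ext => x; ring.
      by apply: L2_mul => //; exact: L2_scale.
    rewrite /H1norm (sq h) // (sq hx) // -Rmult_plus_distr_l sqrt_mult_alt; last nra.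
    by rewrite sqrt_pow2 //; lra.
  have m1 := Rmin_l d1 d2; have m2 := Rmin_r d1 d2; rewrite -/del in m1 m2.
  have := D1 _ _ Hth; have := D2 _ _ Hth; rewrite nth !L2inner_scale //.
  move=> /(_ ltac:(lra)) B2 /(_ ltac:(lra)) B1.
  have B : Rabs (t * d) <= 2 * eps * (t * N).
    apply: Rabs_le; move/Rabs_le_between: B1 => B1; move/Rabs_le_between: B2 => B2.
    by rewrite /d; lra.
  move: B; rewrite Rabs_mult (Rabs_pos_eq t); [nra | lra].
have d0 : Rabs d <= 0.
  apply: Rnot_lt_le => dpos.
  have := H (Rabs d / (4 * (N + 1))) ltac:(apply: Rdiv_lt_0_compat; lra).
  have -> : 2 * (Rabs d / (4 * (N + 1))) * N = Rabs d * (N / (2 * (N + 1))).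
    by field; lra.
  have : N / (2 * (N + 1)) < 1.
    by apply/Rlt_div_l; lra.
  nra.
have := Rabs_pos d; move=> ?; have : Rabs d = 0 by lra.
by move/Rabs_eq_0; rewrite /d; lra.
Qed.

Definition disc (k : R) : R := sqrt (k ^ 4 - k ^ 2 + 1).

Definition g (k : R) : R := 64 * ellK k ^ 2 * disc k.

Definition mtilde (L k : R) : R := L ^ 2 - 64 * ellK k ^ 2 * disc k.

Definition c (L k : R) : R := L ^ 2 / mtilde L k.

Definition A (L k : R) : R :=
  - 204800 * ellK k ^ 6 / (27 * mtilde L k ^ 3)
  * (disc k - (2 * k ^ 2 - 1)) ^ 2 * (2 * disc k + (2 * k ^ 2 - 1)).

Definition phi (L k x : R) : R :=
  (5 / 12 * ((L ^ 2 - 64 * (2 * k ^ 2 - 1) * ellK k ^ 2) / mtilde L k - 1)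
   + 80 * k ^ 2 * ellK k ^ 2 / mtilde L k
     * cn (2 * ellK k / L * x) k ^ 2) ^ 2.

Definition dk_phi (L k x : R) : R := Derive (fun k' => phi L k' x) k.

Definition linop (L k : R) (f : R -> R) (x : R) : R :=
  - c L k * Derive_n f 2 x + (c L k - 1) * f x - 3 / 2 * sqrt (phi L k x) * f x.

Definition Q (L : R) (u ux : R -> R) : R :=
  / 2 * intL L (fun x => u x ^ 2 + ux x ^ 2).

Definition V (L : R) (u : R -> R) : R := intL L u.

Definition M (L k : R) (u ux : R -> R) : R :=
  Derive (c L) k * Q L u ux + Derive (A L) k * V L u.

(* Existence of M_k'(u) at a smooth periodic u. *)
Lemma M_is_L2_derivative L k u : smooth_per L u ->
  is_L2_derivative L (M L k) u (Derive u)
    (fun x => Derive (c L) k * (u x - Derive_n u 2 x) + Derive (A L) k).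
Proof.
move=> su; have su1 := smooth_Derive _ _ su; have su2 := smooth_Derive _ _ su1.
set a := Derive (c L) k; set b := Derive (A L) k.
have cu := smooth_cont _ _ su; have cu1 := smooth_cont _ _ su1.
have cu2 := smooth_cont _ _ su2.
have Lu := cont_L2 L _ cu; have Lu1 := cont_L2 L _ cu1.
have Lu2 := cont_L2 L _ cu2.
have L1 : L2per L (fun _ => 1).
  by apply: cont_L2 => x; apply: continuity_pt_const.
split.
  apply: cont_L2 => x; apply: continuity_pt_plus; last exact: continuity_pt_const.
  apply: continuity_pt_mult; first exact: continuity_pt_const.
  by apply: continuity_pt_minus; [exact: cu|exact: cu2].
move=> eps eps0; exists (2 * eps / (Rabs a + 1)).
  by apply: Rdiv_lt_0_compat; [lra | have := Rabs_pos a; lra].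
move=> h hx [Lh Lhx wd] hsmall.
have E1 : M L k (fun x => u x + h x) (fun x => Derive u x + hx x)
    - M L k u (Derive u)
    = a * (L2inner L u h + L2inner L (Derive u) hx
           + / 2 * (L2inner L h h + L2inner L hx hx)) + b * intL L h.
  have intN f : L2per L f -> integrable_per L f.
    move=> Lf; have := L2_mul _ _ _ Lf L1; congr (is_true (integrable _ _ _)).
    by apply/funext => x /=; rewrite Rmult_1_r.
  have intQ f f' : L2per L f -> L2per L f' ->
      intL L (fun x => f x ^ 2 + f' x ^ 2) = L2inner L f f + L2inner L f' f'.
    move=> Lf Lf'; rewrite -intLD; try exact: L2_mul.
    by apply: intL_ext => x; ring.
  have -> : M L k (fun x => u x + h x) (fun x => Derive u x + hx x) =
     a * (/ 2 * (intL L (fun x => u x ^ 2 + Derive u x ^ 2)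
       + (intL L (fun x => h x ^ 2 + hx x ^ 2)
         + 2 * (L2inner L u h + L2inner L (Derive u) hx))))
     + b * (intL L u + intL L h).
    rewrite /M /V /Q (intLD _ _ _ (intN _ Lu) (intN _ Lh)).
    congr (_ * (_ * _) + _).
    have Iq f f' : L2per L f -> L2per L f' ->
      integrable_per L (fun x => f x * f' x) by exact: L2_mul.
    transitivity (intL L (fun x => (u x * u x + Derive u x * Derive u x)
      + ((h x * h x + hx x * hx x)
         + 2 * (u x * h x + Derive u x * hx x)))).
      by apply: intL_ext => x; ring.
    rewrite !intQ // /L2inner.
    rewrite !intLD ?intLZ ?intLD //;
      by do ? [exact: Iq | apply: integrable_perD | apply: integrable_perZ].
  rewrite /M /V /Q !intQ // -/a -/b. field.
have E2 : L2inner L (fun x => a * (u x - Derive_n u 2 x) + b) h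
    = a * (L2inner L u h - L2inner L (Derive_n u 2) h) + b * intL L h.
  have Ih : integrable_per L h.
    have := L2_mul _ _ _ Lh L1; congr (is_true (integrable _ _ _)).
    by apply/funext => x /=; rewrite Rmult_1_r.
  have I1 := L2_mul _ _ _ Lu Lh; have I2 := L2_mul _ _ _ Lu2 Lh.
  transitivity (intL L (fun x => a * (u x * h x) + (- a * (Derive_n u 2 x * h x) + b * h x))).
    by apply: intL_ext => x; ring.
  rewrite !intLD ?intLZ //;
    do ? [apply: integrable_perD | apply: integrable_perZ] => //.
  by rewrite /L2inner; ring.
have E3 : L2inner L (Derive_n u 2) h = - L2inner L (Derive u) hx.
  have := wd _ su1.
  rewrite /L2inner => wd1; transitivity (intL L (fun x => h x * Derive_n u 2 x)).
    by apply: intL_ext => x; ring.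
  by rewrite wd1; congr (- _); apply: intL_ext => x; ring.
have N0 : 0 <= L2inner L h h + L2inner L hx hx.
  by apply: Rplus_le_le_0_compat; apply: intL_ge0 => x; nra.
have -> : M L k (fun x => u x + h x) (fun x => Derive u x + hx x)
    - M L k u (Derive u)
    - L2inner L (fun x => a * (u x - Derive_n u 2 x) + b) h
  = a / 2 * (H1norm L h hx * H1norm L h hx).
  by rewrite /H1norm sqrt_sqrt // E1 E2 E3; field.
have n0 : 0 <= H1norm L h hx by exact: sqrt_pos.
rewrite Rabs_mult (Rabs_pos_eq (_ * _)); last nra.
rewrite /Rdiv Rabs_mult (Rabs_pos_eq (/ 2)); last lra.
have a0 := Rabs_pos a.
have hs : H1norm L h hx * (Rabs a + 1) < 2 * eps.
  apply: (Rmult_lt_reg_r (/ (Rabs a + 1))); first by apply: Rinv_0_lt_compat; lra.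
  by rewrite Rmult_assoc Rinv_r; [rewrite Rmult_1_r | lra].
nra.
Qed.

(* M_k'(phi_k), as an element of L^2_per. *)
Definition dM_phi (L k : R) : R -> R :=
  L2_derivative L (M L k) (phi L k) (Derive (phi L k)).

(* Main.v *)
(* Put [U = 64 K^2 (3 k^2 cn^2 - (2 k^2 - 1))] and [G = g k], so that
   [phi_k = (25/144) (G + U)^2 / mtilde^2] and, after this rescaling, the
   profile [eta = (25/144) (G + U)^2] and its equation no longer depend on
   [mtilde]. Differentiating the equation of [phi_k] in [k] gives
   [L_k (dk phi_k) = - M_k' (phi_k)] pointwise. For the sign, [U] is a
   Weierstrass function: [U'' = - (U^2 - G^2) / (8 L^2)] together with its
   linearization in [k] makes the mean of every monomial [U^i] and [U^i dU/dk]
   computable from exact derivatives. Writing [eta', G', B'] for k-derivatives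
   ([B] being [A mtilde^3]), [mtilde^7 (M_k' (phi_k), dk phi_k)] is, up to the
   factor [L], the mean of
     [mtilde^2 (G' eta + B') eta' + 4 mtilde G' eta (G' eta + B')
      + 2 G'^2 (L^2 eta_x^2 + G eta^2 + 3 B eta)].
   The squares are nonnegative, and so is the second term since [G', B' >= 0].
   The means of the two others are polynomials in [p = W / G] and
   [r = D / (2 G^3)], with [W] the mean of [U] and [D] the constant of its first
   integral; they are positive on account of [sqrt (1 - k^2) <= E / K <= 1 - k^2 / 2]. *)
From mathcomp Require Import all_boot all_order all_algebra all_classical.
From mathcomp Require Import topology normedtype lebesgue_integral derive ftc.
From mathcomp Require Import Rstruct Rstruct_topology.
From Stdlib Require Import Reals Lra ClassicalEpsilon.
From Coquelicot Require Import Coquelicot.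
Require Import Defs.
Import numFieldNormedType.Exports GRing.Theory.
Local Open Scope R_scope.

(** * Elementary facts on derivatives of real functions *)

Lemma is_derive_continuity_pt (f : R -> R) (x l : R) :
  is_derive f x l -> continuity_pt f x.
Proof. by move=> df; apply/continuity_pt_filterlim/ex_derive_continuous; exists l. Qed.

Lemma const_of_derive_0 (f : R -> R) (x y : R) :
  (forall z, is_derive f z 0) -> f x = f y.
Proof.
move=> df; have [z [_]] := MVT_gen f x y (fun _ => 0) (fun z _ => df z)
  (fun z _ => is_derive_continuity_pt _ _ _ (df z)).
lra.
Qed.

Lemma is_derive_value (f : R -> R) (x l l' : R) : is_derive f x l -> l = l' -> is_derive f x l'.
Proof. by move=> H <-. Qed.

(** * Elliptic integrals and the amplitude *)

Definition ellD (k p : R) : R := sqrt (1 - k ^ 2 * sin p ^ 2).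

Definition ellE (k p : R) : R := RInt (ellD k) 0 p.

Lemma ellD_arg_bounds (k p : R) : 0 < k < 1 ->
  1 - k ^ 2 <= 1 - k ^ 2 * sin p ^ 2 <= 1.
Proof.
move=> hk; have := SIN_bound p => sb.
have : 0 <= sin p ^ 2 <= 1 by nra.
nra.
Qed.

Lemma ellD_arg_pos (k p : R) : 0 < k < 1 -> 0 < 1 - k ^ 2 * sin p ^ 2.
Proof. by move=> hk; have := ellD_arg_bounds k p hk; nra. Qed.

Lemma ellD_pos (k p : R) : 0 < k < 1 -> 0 < ellD k p.
Proof. by move=> hk; exact: sqrt_lt_R0 (ellD_arg_pos k p hk). Qed.

Lemma ellD_sqr (k p : R) : 0 < k < 1 -> ellD k p ^ 2 = 1 - k ^ 2 * sin p ^ 2.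
Proof. by move=> hk; apply: pow2_sqrt; have := ellD_arg_pos k p hk; lra. Qed.

Lemma ellD_le1 (k p : R) : 0 < k < 1 -> ellD k p <= 1.
Proof.
move=> hk; rewrite -sqrt_1; apply: sqrt_le_1_alt.
by have := ellD_arg_bounds k p hk; lra.
Qed.

Lemma ellD_derive (k p : R) : 0 < k < 1 ->
  is_derive (ellD k) p (- k ^ 2 * sin p * cos p / ellD k p).
Proof.
move=> hk; have := ellD_arg_pos k p hk => h; have h' := ellD_pos k p hk.
rewrite /ellD; auto_derive; first by simpl in h |- *; lra.
rewrite -/(ellD k p) /=; move: h'; rewrite /ellD /= => h'; field; lra.
Qed.

Lemma is_derive_RInt0 (f : R -> R) (p : R) :
  (forall t, continuous f t) -> is_derive (fun p => RInt f 0 p) p (f p).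
Proof.
move=> cf; apply: is_derive_RInt; last exact: cf.
by apply: filter_forall => q; apply: RInt_correct; apply: ex_RInt_continuous.
Qed.

Lemma ellD_continuous (k p : R) : 0 < k < 1 -> continuous (ellD k) p.
Proof.
move=> hk; apply: ex_derive_continuous; exists (- k ^ 2 * sin p * cos p / ellD k p).
exact: ellD_derive.
Qed.

Lemma ellE_derive (k p : R) : 0 < k < 1 -> is_derive (ellE k) p (ellD k p).
Proof. by move=> hk; apply: is_derive_RInt0 => t; exact: ellD_continuous. Qed.

Lemma inv_ellD_continuous (k p : R) : 0 < k < 1 -> continuous (fun t => / ellD k t) p.
Proof.
move=> hk; apply: ex_derive_continuous; auto_derive; split => //.
  by exists (- k ^ 2 * sin p * cos p / ellD k p); exact: ellD_derive.
by have := ellD_pos k p hk; lra.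
Qed.

Lemma ellF_derive (k p : R) : 0 < k < 1 -> is_derive (ellF k) p (/ ellD k p).
Proof.
move=> hk; apply: (is_derive_RInt0 (fun t => / ellD k t)) => t.
exact: inv_ellD_continuous.
Qed.

Lemma ellF_0 (k : R) : ellF k 0 = 0.
Proof. exact: RInt_point. Qed.

Lemma ellE_0 (k : R) : ellE k 0 = 0.
Proof. exact: RInt_point. Qed.

Lemma ellD_refl (k p : R) : ellD k (PI - p) = ellD k p.
Proof. by rewrite /ellD sin_PI_x. Qed.

Lemma ellD_shift (k p : R) : ellD k (p + PI) = ellD k p.
Proof. by rewrite /ellD neg_sin; congr sqrt; ring. Qed.

(** By the symmetries of [f], both [F p + F (PI - p)] and [F (p + PI) - F p] have zero derivative,
    hence are constant. *)
Lemma quarter_period (f F : R -> R) (p : R) :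
  (forall p, is_derive F p (f p)) -> (forall p, f (PI - p) = f p) ->
  (forall p, f (p + PI) = f p) -> F 0 = 0 ->
  F PI = 2 * F (PI / 2) /\ F (p + PI) = F p + 2 * F (PI / 2).
Proof.
move=> dF fr fs F0.
have FPI : F PI = 2 * F (PI / 2).
  have := const_of_derive_0 (fun p => F p + F (PI - p)) 0 (PI / 2).
  have -> : PI - PI / 2 = PI / 2 by field.
  rewrite F0 Rminus_0_r => H; suff : 0 + F PI = F (PI / 2) + F (PI / 2) by lra.
  apply: H.
  move=> z; auto_derive.
    by split; [exists (f z) | split => //; exists (f (PI - z))].
  rewrite (is_derive_unique _ _ _ (dF z)) (is_derive_unique _ _ _ (dF (PI + - z))).
  by rewrite -/(PI - z) fr; ring.
split=> //; rewrite -FPI.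
have := const_of_derive_0 (fun p => F (p + PI) - F p) p 0.
rewrite F0 Rplus_0_l => H; suff : F (p + PI) - F p = F PI - 0 by lra.
apply: H => z; auto_derive.
  by split; [exists (f (z + PI)) | split => //; exists (f z)].
by rewrite (is_derive_unique _ _ _ (dF z)) (is_derive_unique _ _ _ (dF (z + PI))) fs; ring.
Qed.

Lemma ellF_quarter (k p : R) : 0 < k < 1 ->
  ellF k PI = 2 * ellK k /\ ellF k (p + PI) = ellF k p + 2 * ellK k.
Proof.
move=> hk; apply: (quarter_period (fun t => / ellD k t)).
- by move=> t; exact: ellF_derive.
- by move=> t; rewrite ellD_refl.
- by move=> t; rewrite ellD_shift.
- exact: ellF_0.
Qed.

Lemma ellE_PI (k : R) : 0 < k < 1 -> ellE k PI = 2 * ellE k (PI / 2).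
Proof.
move=> hk; apply: (proj1 (quarter_period (ellD k) _ 0 _ _ _ _)).
- by move=> t; exact: ellE_derive.
- exact: ellD_refl.
- exact: ellD_shift.
- exact: ellE_0.
Qed.

(** Since [ellD] is at most 1, [ellF k] has slope at least 1. This makes it injective and, by the
    intermediate value theorem, onto, so that [am] is its inverse. *)
Lemma ellF_expand (k p q : R) : 0 < k < 1 -> p <= q -> q - p <= ellF k q - ellF k p.
Proof.
move=> hk pq.
have [z [_ ->]] := MVT_gen (ellF k) p q (fun t => / ellD k t)
  (fun z _ => ellF_derive k z hk)
  (fun z _ => is_derive_continuity_pt _ _ _ (ellF_derive k z hk)).
have h1 := ellD_le1 k z hk; have h0 := ellD_pos k z hk.
have : 1 <= / ellD k z by rewrite -Rinv_1; apply: Rinv_le_contravar.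
by nra.
Qed.

Lemma ellF_inj (k p q : R) : 0 < k < 1 -> ellF k p = ellF k q -> p = q.
Proof.
move=> hk e; case: (Rle_or_lt p q) => h.
  by have := ellF_expand k p q hk h; lra.
by have := ellF_expand k q p hk (Rlt_le _ _ h); lra.
Qed.

Lemma ellF_am (x k : R) : 0 < k < 1 -> ellF k (am x k) = x.
Proof.
move=> hk; apply: (epsilon_spec (inhabits 0) (fun p => ellF k p = x)).
have h1 := ellF_expand k 0 (Rabs x) hk (Rabs_pos x).
have h2 := ellF_expand k (- Rabs x) 0 hk ltac:(have := Rabs_pos x; lra).
rewrite ellF_0 in h1 h2.
have hx := Rabs_le_between x (Rabs x); have {}hx := proj1 hx (Rle_refl _).
have [p [_ hp]] := IVT_gen (ellF k) (- Rabs x) (Rabs x) x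
   (fun z => is_derive_continuity_pt _ _ _ (ellF_derive k z hk))
   ltac:(rewrite Rmin_left ?Rmax_right; lra).
by exists p.
Qed.

Lemma am_shift (x k : R) : 0 < k < 1 -> am (x + 2 * ellK k) k = am x k + PI.
Proof.
move=> hk; apply: (ellF_inj k) => //; rewrite ellF_am //.
by rewrite (proj2 (ellF_quarter k _ hk)) ellF_am.
Qed.

Lemma am_0 (k : R) : 0 < k < 1 -> am 0 k = 0.
Proof. by move=> hk; apply: (ellF_inj k) => //; rewrite ellF_am // ellF_0. Qed.

Lemma am_2K (k : R) : 0 < k < 1 -> am (2 * ellK k) k = PI.
Proof. by move=> hk; have := am_shift 0 k hk; rewrite am_0 // !Rplus_0_l. Qed.

(* For [x] near [x0], [a x - a x0 = h x * G x xi] with [xi] between [a x0] and [a x]. *)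
Lemma implicit_derive (F G : R -> R -> R) (a h : R -> R) (x0 l : R) :
  locally x0 (fun x => forall p, is_derive (F x) p (/ G x p) /\ 0 < G x p <= 1) ->
  continuity_2d_pt G x0 (a x0) ->
  locally x0 (fun x => F x (a x) - F x (a x0) = h x) ->
  is_derive h x0 l -> is_derive a x0 (l * G x0 (a x0)).
Proof.
move=> [d1 dF] cG [d2 Fa] dh; set G0 := G x0 (a x0).
have slope x : Rabs (x - x0) < d1 -> Rabs (x - x0) < d2 ->
    exists xi, a x - a x0 = h x * G x xi /\ Rabs (xi - a x0) <= Rabs (h x) /\ 0 < G x xi <= 1.
  move=> x1 x2; have {dF} dF := dF x x1; have {Fa} Fa := Fa x x2.
  have [xi [xiP E]] := MVT_gen (F x) (a x0) (a x) (fun p => / G x p)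
    (fun p _ => proj1 (dF p))
    (fun p _ => is_derive_continuity_pt _ _ _ (proj1 (dF p))).
  have [_ g01] := dF xi.
  have E' : a x - a x0 = h x * G x xi by rewrite -Fa E; field; lra.
  exists xi; split=> //; split=> //.
  apply: (Rle_trans _ (Rabs (a x - a x0))); last first.
    by rewrite E' Rabs_mult (Rabs_pos_eq (G x xi)); [have := Rabs_pos (h x); nra | lra].
  move: xiP; rewrite /Rmin /Rmax /Rabs.
  by repeat case: Rle_dec => ?; repeat case: Rcase_abs => ?; lra.
have h0 : h x0 = 0.
  have <- : F x0 (a x0) - F x0 (a x0) = h x0.
    by apply: Fa; exact: ball_center.
  by ring.
apply/is_derive_Reals => eps eps0.
have e1 : 0 < eps / 2 by lra.
have e2 : 0 < eps / 2 / (Rabs l + 1).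
  by apply: Rdiv_lt_0_compat => //; have := Rabs_pos l; lra.
have [d3 d3P] := cG (mkposreal _ e2).
have [d4 d4P] := proj1 (is_derive_Reals h x0 l) dh _ e1.
have [d5 [d50 d5P]] := is_derive_continuity_pt _ _ _ dh d3 (cond_pos d3).
have dpos : 0 < Rmin (Rmin d1 d2) (Rmin d3 (Rmin d4 d5)).
  by repeat apply: Rmin_pos => //; exact: cond_pos.
exists (mkposreal _ dpos) => t t0 /= td.
have [t1 [t2 [t3 [t4 t5]]]] : Rabs t < d1 /\ Rabs t < d2 /\ Rabs t < d3 /\ Rabs t < d4 /\ Rabs t < d5.
  have := Rmin_l (Rmin d1 d2) (Rmin d3 (Rmin d4 d5)).
  have := Rmin_r (Rmin d1 d2) (Rmin d3 (Rmin d4 d5)).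
  have := Rmin_l d1 d2; have := Rmin_r d1 d2; have := Rmin_l d3 (Rmin d4 d5).
  have := Rmin_r d3 (Rmin d4 d5); have := Rmin_l d4 d5; have := Rmin_r d4 d5.
  lra.
have tE : x0 + t - x0 = t by ring.
have [xi [E [xis g01]]] := slope (x0 + t) ltac:(by rewrite tE) ltac:(by rewrite tE).
have hs : Rabs (h (x0 + t)) < d3.
  have := d5P (x0 + t); rewrite /= /Rdist h0 Rminus_0_r tE; apply.
  by split => //; split => // ?; lra.
have gs : Rabs (G (x0 + t) xi - G0) < eps / 2 / (Rabs l + 1).
  by apply: d3P; [rewrite tE | lra].
have {d4P} hq := d4P t t0 t4; rewrite h0 Rminus_0_r in hq.
rewrite E; set gg := G _ xi in gs g01 *.
have -> : h (x0 + t) * gg / t - l * G0 = (h (x0 + t) / t - l) * gg + l * (gg - G0).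
  by field.
apply: Rle_lt_trans (Rabs_triang _ _) _; rewrite !Rabs_mult (Rabs_pos_eq gg); last lra.
have l0 := Rabs_pos l; have := Rabs_pos (gg - G0).
have : eps / 2 = (Rabs l + 1) * (eps / 2 / (Rabs l + 1)) by field; lra.
have := Rabs_pos (h (x0 + t) / t - l).
nra.
Qed.

Lemma ellD_continuity_2d (k p : R) : 0 < k < 1 -> continuity_2d_pt ellD k p.
Proof.
move=> hk; apply: (continuity_1d_2d_pt_comp sqrt (fun k p => 1 - k ^ 2 * sin p ^ 2)).
  by apply: continuity_pt_sqrt; have := ellD_arg_pos k p hk; lra.
apply: continuity_2d_pt_minus; first exact: continuity_2d_pt_const.
apply: continuity_2d_pt_mult.
  apply: (continuity_1d_2d_pt_comp (fun k => k ^ 2) (fun k p => k)).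
    by apply: derivable_continuous_pt; apply: derivable_pt_pow.
  exact: continuity_2d_pt_id1.
apply: (continuity_1d_2d_pt_comp (fun p => sin p ^ 2) (fun k p => p)).
  by apply: (is_derive_continuity_pt _ _ (2 * sin p * cos p)); auto_derive => //; ring.
exact: continuity_2d_pt_id2.
Qed.

Lemma locally_unit (k : R) : 0 < k < 1 -> locally k (fun k => 0 < k < 1).
Proof.
move=> [h0 h1]; apply: filter_and; first exact: open_gt.
exact: open_lt.
Qed.

Lemma am_derive (x k : R) : 0 < k < 1 ->
  is_derive (fun x => am x k) x (ellD k (am x k)).
Proof.
move=> hk.
have -> : ellD k (am x k) = 1 * (fun _ => ellD k) x (am x k) by rewrite /=; ring.
apply: (implicit_derive (fun _ => ellF k) (fun _ => ellD k) (fun x => am x k) (fun y => y - x)).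
- apply: filter_forall => _ p; split; first exact: ellF_derive.
  by split; [exact: ellD_pos | exact: ellD_le1].
- apply: (continuity_1d_2d_pt_comp (ellD k) (fun _ p => p)).
    exact: is_derive_continuity_pt (ellD_derive _ _ hk).
  exact: continuity_2d_pt_id2.
- by apply: filter_forall => y; rewrite !ellF_am.
- by auto_derive => //; ring.
Qed.

Lemma is_derive_const_eq (f h l : R -> R) (x y : R) :
  (forall z, is_derive f z (l z)) -> (forall z, is_derive h z (l z)) ->
  f y = h y -> f x = h x.
Proof.
move=> df dh e; suff : f x - h x = f y - h y by lra.
apply: (const_of_derive_0 (fun x => f x - h x)) => z.
by apply: is_derive_value; [apply: is_derive_minus; [exact: df | exact: dh] | exact: Rminus_diag_eq].
Qed.

Lemma inv_ellD_derive_modulus (k t : R) : 0 < k < 1 ->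
  is_derive (fun k => / ellD k t) k (k * sin t ^ 2 / ellD k t ^ 3).
Proof.
move=> hk; have h := ellD_arg_pos k t hk; have h' := ellD_pos k t hk.
rewrite /ellD; auto_derive; have -> : 1 + - (k * (k * 1) * (sin t * (sin t * 1)))
  = 1 - k ^ 2 * sin t ^ 2 by ring.
  by rewrite -/(ellD k t); repeat split => //; lra.
by rewrite -/(ellD k t); field; lra.
Qed.

(** The formula is a closed form of the integral of [k sin^2 / ellD^3]: both vanish at [p = 0] and
    have the same derivative in [p]. It remains to differentiate under the integral sign. *)
Lemma ellF_derive_modulus (k p : R) : 0 < k < 1 ->
  is_derive (fun k => ellF k p) k
    (((ellE k p - k ^ 2 * sin p * cos p / ellD k p) / (1 - k ^ 2) - ellF k p) / k).
Proof.
move=> hk.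
have D1 u v : 0 < u < 1 -> Derive (fun k => / ellD k v) u = u * sin v ^ 2 / ellD u v ^ 3.
  by move=> hu; apply: is_derive_unique; exact: inv_ellD_derive_modulus.
have dP t : is_derive (fun p =>
    ((ellE k p - k ^ 2 * sin p * cos p / ellD k p) / (1 - k ^ 2) - ellF k p) / k) t
    (k * sin t ^ 2 / ellD k t ^ 3).
  have h' := ellD_pos k t hk; have hs := ellD_sqr k t hk.
  have dD := ellD_derive k t hk; have dE := ellE_derive k t hk; have dF := ellF_derive k t hk.
  auto_derive.
    repeat split => //; [by eexists; exact: dE | by eexists; exact: dD | lra | by eexists; exact: dF].
  rewrite (is_derive_unique (fun x => ellE k x) _ _ dE) (is_derive_unique (fun x => ellF k x) _ _ dF)
    (is_derive_unique (fun x => ellD k x) _ _ dD).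
  have hc : cos t ^ 2 = 1 - sin t ^ 2 by have := sin2_cos2 t; rewrite /Rsqr; lra.
  move: hs hc h'; set d := ellD k t; set s := sin t; set cc := cos t => hs hc h'.
  have hk2 : k ^ 2 * s ^ 2 = 1 - d ^ 2 by lra.
  have hkc : k ^ 2 * cc ^ 2 = k ^ 2 - 1 + d ^ 2 by rewrite hc; lra.
  have k21 : 1 - k ^ 2 <> 0 by nra.
  transitivity (((d - (k ^ 2 * cc ^ 2 - k ^ 2 * s ^ 2) / d
    - (k ^ 2 * s ^ 2) * (k ^ 2 * cc ^ 2) / d ^ 3) / (1 - k ^ 2) - / d) / k).
    by field; repeat split; nra.
  transitivity (k ^ 2 * s ^ 2 / (k * d ^ 3)); last by field; lra.
  by rewrite hkc hk2; field; repeat split; nra.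
have -> : ((ellE k p - k ^ 2 * sin p * cos p / ellD k p) / (1 - k ^ 2) - ellF k p) / k
  = RInt (fun t => Derive (fun k => / ellD k t) k) 0 p.
  rewrite (RInt_ext _ (fun t => k * sin t ^ 2 / ellD k t ^ 3)); last by move=> t _; exact: D1.
  apply: (is_derive_const_eq (fun p =>
    ((ellE k p - k ^ 2 * sin p * cos p / ellD k p) / (1 - k ^ 2) - ellF k p) / k)
   (fun p => RInt (fun t => k * sin t ^ 2 / ellD k t ^ 3) 0 p) _ p 0).
  - exact: dP.
  - move=> z; apply: (is_derive_RInt0 (fun t => k * sin t ^ 2 / ellD k t ^ 3)) => t.
    apply: ex_derive_continuous; auto_derive; split.
      by eexists; exact: ellD_derive.
    split => //; have h' := ellD_pos k t hk.
    by apply: Rgt_not_eq; repeat apply: Rmult_lt_0_compat => //; lra.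
  - rewrite RInt_point ellE_0 ellF_0 sin_0 /zero /=; have h' := ellD_pos k 0 hk.
    by field; repeat split; nra.
apply: (is_derive_RInt_param (fun k t => / ellD k t)).
- apply: (filter_imp _ _ _ (locally_unit k hk)) => u hu t _.
  by eexists; exact: inv_ellD_derive_modulus.
- move=> t _.
  apply: (continuity_2d_pt_ext_loc (fun u v => u * sin v ^ 2 * / ellD u v ^ 3)).
    have [d lP] := locally_unit k hk.
    by exists d => u v hu _; rewrite D1 //; exact: lP.
  apply: continuity_2d_pt_mult.
    apply: continuity_2d_pt_mult; first exact: continuity_2d_pt_id1.
    apply: (continuity_1d_2d_pt_comp (fun p => sin p ^ 2) (fun k p => p)).
      by apply: (is_derive_continuity_pt _ _ (2 * sin t * cos t)); auto_derive => //; ring.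
    exact: continuity_2d_pt_id2.
  have h' := ellD_pos k t hk.
  apply: (continuity_1d_2d_pt_comp (fun y => / y ^ 3) ellD); last exact: ellD_continuity_2d.
  apply: (is_derive_continuity_pt _ _ (- 3 * / ellD k t ^ 4)); auto_derive.
    by apply: Rgt_not_eq; repeat apply: Rmult_lt_0_compat => //; lra.
  by field; lra.
- apply: (filter_imp _ _ _ (locally_unit k hk)) => u hu.
  by apply: ex_RInt_continuous => t _; exact: inv_ellD_continuous.
Qed.

(** Implicit differentiation of [ellF u (am (v u) u) = v u], where argument and modulus move
    together. *)
Lemma am_derive_modulus (v : R -> R) (dv k : R) : 0 < k < 1 -> is_derive v k dv ->
  let a := am (v k) k in
  is_derive (fun k => am (v k) k) k
    ((dv - ((ellE k a - k ^ 2 * sin a * cos a / ellD k a) / (1 - k ^ 2) - v k) / k)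
     * ellD k a).
Proof.
move=> hk dv' a; have lk := locally_unit k hk.
apply: (implicit_derive ellF ellD (fun k => am (v k) k) (fun u => v u - ellF u a)).
- apply: (filter_imp _ _ _ lk) => u hu p; split; first exact: ellF_derive.
  by split; [exact: ellD_pos | exact: ellD_le1].
- exact: ellD_continuity_2d.
- by apply: (filter_imp _ _ _ lk) => u hu; rewrite ellF_am.
- apply: is_derive_minus => //; rewrite -{1}(ellF_am (v k) k hk).
  exact: ellF_derive_modulus.
Qed.

Lemma ellK_derive (k : R) : 0 < k < 1 ->
  is_derive ellK k ((ellE k (PI / 2) / (1 - k ^ 2) - ellK k) / k).
Proof.
move=> hk; apply: is_derive_value; first exact: (ellF_derive_modulus k (PI / 2)).
by rewrite /ellK cos_PI2; have h := ellD_pos k (PI / 2) hk; field; repeat split; nra.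
Qed.

Lemma ellK_pos (k : R) : 0 < k < 1 -> 0 < ellK k.
Proof.
move=> hk; have hp := PI_RGT_0; have := ellF_expand k 0 (PI / 2) hk.
by rewrite ellF_0 /ellK; lra.
Qed.

(** This is the mean of [dn^2] over a period. *)
Definition eratio (k : R) : R := ellE k (PI / 2) / ellK k.


(* [ellD - k'^2 / ellD^3] is the derivative of [k^2 sin cos / ellD], which vanishes
   at both ends, so that twice the mean of [ellD^2] is the mean of [ellD^2 + k'^2 / ellD^2]. *)
Lemma ellE_bound (k b s : R) : 0 < k < 1 ->
  (forall d, 0 < d -> 1 - k ^ 2 <= d ^ 2 <= 1 -> 0 <= s * (d ^ 2 + (1 - k ^ 2) / d ^ 2 - b)) ->
  0 <= s * (2 * ellE k (PI / 2) - b * ellK k).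
Proof.
move=> hk hs.
pose f p := s * (2 * ellE k p - k ^ 2 * sin p * cos p / ellD k p - b * ellF k p).
pose f' p := s * (ellD k p ^ 2 + (1 - k ^ 2) / ellD k p ^ 2 - b) / ellD k p.
have df p : is_derive f p (f' p).
  have h := ellD_pos k p hk; have h2 := ellD_sqr k p hk.
  have hc : cos p ^ 2 = 1 - sin p ^ 2 by have := sin2_cos2 p; rewrite /Rsqr; lra.
  have dD := ellD_derive k p hk; have dE := ellE_derive k p hk; have dF := ellF_derive k p hk.
  rewrite /f; auto_derive.
    by repeat split; [eexists; exact: dE | eexists; exact: dD | lra | eexists; exact: dF].
  rewrite (is_derive_unique (fun x => ellE k x) _ _ dE) (is_derive_unique (fun x => ellF k x) _ _ dF)
    (is_derive_unique (fun x => ellD k x) _ _ dD) /f'.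
  move: h h2 hc; set d := ellD k p; set sn := sin p; set cs := cos p => h h2 hc.
  transitivity (s * (2 * d - (k ^ 2 * cs ^ 2 - k ^ 2 * sn ^ 2) / d
    - (k ^ 2 * sn ^ 2) * (k ^ 2 * cs ^ 2) / d ^ 3 - b / d)); first by field; lra.
  have -> : k ^ 2 * cs ^ 2 = k ^ 2 - (1 - d ^ 2) by rewrite hc h2; ring.
  have -> : k ^ 2 * sn ^ 2 = 1 - d ^ 2 by rewrite h2; ring.
  by field; lra.
have [z [_]] := MVT_gen f 0 (PI / 2) f' (fun z _ => df z)
  (fun z _ => is_derive_continuity_pt _ _ _ (df z)).
have -> : f 0 = 0 by rewrite /f ellE_0 ellF_0 sin_0; field; have := ellD_pos k 0 hk; lra.
rewrite {1}/f cos_PI2 -/(ellK k).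
have -> : k ^ 2 * sin (PI / 2) * 0 / ellD k (PI / 2) = 0 by field; have := ellD_pos k (PI / 2) hk; lra.
rewrite !Rminus_0_r => ->; apply: Rmult_le_pos; last by have := PI_RGT_0; lra.
have h := ellD_pos k z hk; apply: Rmult_le_pos; last by apply: Rlt_le; exact: Rinv_0_lt_compat.
by apply: hs => //; rewrite ellD_sqr //; exact: ellD_arg_bounds.
Qed.

(** [ellE_bound] with [s = 1]: by the arithmetic-geometric inequality, [d^2 + t^2 / d^2] is at least
    [2 t]. *)
Lemma eratio_ge (k : R) : 0 < k < 1 -> sqrt (1 - k ^ 2) <= eratio k.
Proof.
move=> hk; have K0 := ellK_pos k hk; set t := sqrt (1 - k ^ 2).
have t2 : t ^ 2 = 1 - k ^ 2 by apply: pow2_sqrt; nra.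
have t0 : 0 <= t by exact: sqrt_pos.
have := ellE_bound k (2 * t) 1 hk; rewrite -t2 => H.
apply/Rle_div_r => //; suff : 0 <= 1 * (2 * ellE k (PI / 2) - 2 * t * ellK k) by lra.
apply: H => d d0 _.
have -> : 1 * (d ^ 2 + t ^ 2 / d ^ 2 - 2 * t) = ((d ^ 2 - t) / d) ^ 2 by field; lra.
exact: pow2_ge_0.
Qed.

(** [ellE_bound] with [s = -1]: for [d^2] between [1 - k^2] and 1, the sum [d^2 + (1 - k^2) / d^2]
    is largest at the two ends, where it equals [2 - k^2]. *)
Lemma eratio_le (k : R) : 0 < k < 1 -> eratio k <= 1 - k ^ 2 / 2.
Proof.
move=> hk; have K0 := ellK_pos k hk.
have H := ellE_bound k (2 - k ^ 2) (-1) hk.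
apply/Rle_div_l => //.
suff : 0 <= -1 * (2 * ellE k (PI / 2) - (2 - k ^ 2) * ellK k) by lra.
apply: H => d d0 hd.
have -> : -1 * (d ^ 2 + (1 - k ^ 2) / d ^ 2 - (2 - k ^ 2))
  = (1 - d ^ 2) * (d ^ 2 - (1 - k ^ 2)) * / d ^ 2 by field; lra.
apply: Rmult_le_pos; first nra.
by apply: Rlt_le; apply: Rinv_0_lt_compat; nra.
Qed.

(** * The travelling-wave field *)

Definition amp (L k x : R) : R := am (2 * ellK k / L * x) k.

Definition zeta (L k x : R) : R :=
  2 * ellK k / L * eratio k * x - ellE k (amp L k x).

Lemma amp_derive (L k x : R) : 0 < k < 1 ->
  is_derive (amp L k) x (2 * ellK k / L * ellD k (amp L k x)).
Proof.
move=> hk; apply: (is_derive_comp (fun u => am u k) (fun x => 2 * ellK k / L * x)).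
  exact: am_derive.
by auto_derive => //; ring.
Qed.

Lemma sin_amp_derive (L k x : R) : 0 < k < 1 ->
  is_derive (fun x => sin (amp L k x)) x
    (2 * ellK k / L * (cos (amp L k x) * ellD k (amp L k x))).
Proof.
move=> hk; apply: is_derive_value.
  by apply: (is_derive_comp sin (amp L k)); [apply/is_derive_Reals; exact: derivable_pt_lim_sin | exact: amp_derive].
by rewrite /scal /= /mult /=; ring.
Qed.

Lemma cos_amp_derive (L k x : R) : 0 < k < 1 ->
  is_derive (fun x => cos (amp L k x)) x
    (- (2 * ellK k / L) * (sin (amp L k x) * ellD k (amp L k x))).
Proof.
move=> hk; apply: is_derive_value.
  by apply: (is_derive_comp cos (amp L k)); [apply/is_derive_Reals; exact: derivable_pt_lim_cos | exact: amp_derive].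
by rewrite /scal /= /mult /=; ring.
Qed.

Lemma ellD_amp_derive (L k x : R) : 0 < k < 1 ->
  is_derive (fun x => ellD k (amp L k x)) x
    (- (2 * ellK k / L) * k ^ 2 * (sin (amp L k x) * cos (amp L k x))).
Proof.
move=> hk; apply: is_derive_value.
  by apply: (is_derive_comp (ellD k) (amp L k)); [exact: ellD_derive | exact: amp_derive].
have h := ellD_pos k (amp L k x) hk.
rewrite /scal /= /mult /=; set w := _ / L; field; lra.
Qed.

Lemma zeta_derive (L k x : R) : 0 < k < 1 ->
  is_derive (zeta L k) x (2 * ellK k / L * (eratio k - ellD k (amp L k x) ^ 2)).
Proof.
move=> hk; apply: is_derive_value.
  apply: is_derive_minus; last first.
    by apply: (is_derive_comp (ellE k) (amp L k)); [exact: ellE_derive | exact: amp_derive].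
  by auto_derive.
by rewrite /scal /minus /opp /plus /= /mult /=; set w := _ / L; ring.
Qed.

Lemma amp_0 (L k : R) : 0 < k < 1 -> amp L k 0 = 0.
Proof. by move=> hk; rewrite /amp Rmult_0_r am_0. Qed.

Lemma amp_L (L k : R) : 0 < k < 1 -> L <> 0 -> amp L k L = PI.
Proof. by move=> hk L0; rewrite /amp -(am_2K k hk); congr am; field. Qed.

Lemma amp_shift (L k x : R) : 0 < k < 1 -> L <> 0 -> amp L k (x + L) = amp L k x + PI.
Proof. by move=> hk L0; rewrite /amp -am_shift //; congr am; field. Qed.

Lemma zeta_0 (L k : R) : 0 < k < 1 -> zeta L k 0 = 0.
Proof. by move=> hk; rewrite /zeta amp_0 // ellE_0; ring. Qed.

Lemma zeta_L (L k : R) : 0 < k < 1 -> L <> 0 -> zeta L k L = 0.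
Proof.
move=> hk L0; rewrite /zeta amp_L // ellE_PI // /eratio.
by have K0 := ellK_pos k hk; field; lra.
Qed.

(** The derivative of [2 K x / L] grows linearly in [x]; together with [ellE k (amp L k x)] this
    growth is absorbed into [zeta], which vanishes at 0 and [L]. *)
Lemma amp_derive_modulus (L k x : R) : 0 < k < 1 ->
  is_derive (fun k => amp L k x) k
    ((zeta L k x * ellD k (amp L k x) + k ^ 2 * sin (amp L k x) * cos (amp L k x))
      / (k * (1 - k ^ 2))).
Proof.
move=> hk; have dK := ellK_derive k hk.
apply: is_derive_value.
  apply: (am_derive_modulus (fun k => 2 * ellK k / L * x)
    (2 * ((ellE k (PI / 2) / (1 - k ^ 2) - ellK k) / k) / L * x)) => //.
  auto_derive; first by eexists; exact: dK.
  by rewrite (is_derive_unique (fun x => ellK x) _ _ dK) /Rdiv; ring.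
have h := ellD_pos k (amp L k x) hk; have K0 := ellK_pos k hk.
rewrite /zeta /eratio -/(amp L k x); move: h; set a := amp L k x => h; rewrite /Rdiv.
set iL := / L; field; repeat split; nra.
Qed.

(* [field_ux], [field_v], [field_vx] are the derivatives of [field_u] in [x], in [k] and in
   both; [dN] is that of [64 K^2], and [zeta] minus the Jacobi zeta function. *)
Definition field_u (L k x : R) : R :=
  64 * ellK k ^ 2 * (3 * k ^ 2 * cos (amp L k x) ^ 2 - (2 * k ^ 2 - 1)).

Definition field_ux (L k x : R) : R :=
  - (2 * ellK k / L) * (64 * ellK k ^ 2) * (6 * k ^ 2)
  * (sin (amp L k x) * cos (amp L k x) * ellD k (amp L k x)).

Definition dN (k : R) : R := 128 * ellK k ^ 2 * (eratio k - (1 - k ^ 2)) / (k * (1 - k ^ 2)).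

Definition field_v (L k x : R) : R :=
  let s := sin (amp L k x) in let c := cos (amp L k x) in let d := ellD k (amp L k x) in
  dN k * (3 * k ^ 2 * c ^ 2 - (2 * k ^ 2 - 1))
  + 64 * ellK k ^ 2 * (6 * k * c ^ 2 - 4 * k
     - 6 * k / (1 - k ^ 2) * (zeta L k x * (s * c * d) + k ^ 2 * (s * c) ^ 2)).

Definition field_vx (L k x : R) : R :=
  let s := sin (amp L k x) in let c := cos (amp L k x) in let d := ellD k (amp L k x) in
  - (2 * ellK k / L) * (6 * k) * (k * dN k * (s * c * d)
  + 64 * ellK k ^ 2 * (2 * (s * c * d)
     + / (1 - k ^ 2) * (zeta L k x * (c ^ 2 * d ^ 2 - s ^ 2 * d ^ 2 - k ^ 2 * s ^ 2 * c ^ 2)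
        + s * c * d * (eratio k - d ^ 2) + 2 * k ^ 2 * (s * c * d) * (c ^ 2 - s ^ 2)))).

(** With [K] the complete integral, [(2 K / PI)^4 quad] is the Eisenstein series E4 and
    [(2 K / PI)^6 cub] is twice E6. *)
Definition quad (k : R) : R := k ^ 4 - k ^ 2 + 1.
Definition cub (k : R) : R := (2 * k ^ 2 - 1) * (k ^ 4 - k ^ 2 - 2).

Ltac amp_auto_derive L k x hk :=
  let da := fresh in let dd := fresh in let dz := fresh in
  let d_pos := fresh "d_pos" in
  have da := amp_derive L k x hk; have dd := ellD_derive k (amp L k x) hk;
  have dz := zeta_derive L k x hk; have d_pos := ellD_pos k (amp L k x) hk;
  auto_derive; [by repeat split; eexists; first [exact: da | exact: dd | exact: dz] |];
  rewrite ?(is_derive_unique (fun x => amp L k x) _ _ da)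
    ?(is_derive_unique (fun x => ellD k x) _ _ dd)
    ?(is_derive_unique (fun x => zeta L k x) _ _ dz);
  clear da dd dz; move: d_pos;
  set w := 2 * ellK k / L; set s := sin _; set c := cos _; set d := ellD _ _;
  try set z := zeta _ _ _; move=> d_pos.

Lemma field_u_derive (L k x : R) : 0 < k < 1 ->
  is_derive (field_u L k) x (field_ux L k x).
Proof.
move=> hk; rewrite /field_u; amp_auto_derive L k x hk.
by rewrite /field_ux -/s -/c -/d -/w; ring.
Qed.

Lemma field_v_derive (L k x : R) : 0 < k < 1 ->
  is_derive (field_v L k) x (field_vx L k x).
Proof.
move=> hk; rewrite /field_v; amp_auto_derive L k x hk.
rewrite /field_vx -/s -/c -/d -/w -/z; field; repeat split; nra.
Qed.

Lemma amp_relations (L k x : R) : 0 < k < 1 ->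
  sin (amp L k x) ^ 2 = 1 - cos (amp L k x) ^ 2 /\
  ellD k (amp L k x) ^ 2 = 1 - k ^ 2 + k ^ 2 * cos (amp L k x) ^ 2.
Proof.
move=> hk; rewrite ellD_sqr //; have := sin2_cos2 (amp L k x); rewrite /Rsqr => h.
have -> : sin (amp L k x) ^ 2 = 1 - cos (amp L k x) ^ 2 by lra.
by split; ring.
Qed.

(** Half the k-derivative of [(64 K^2)^2 quad = G^2], that is [G G'], whereas [dcubic] is the full
    k-derivative of [(64 K^2)^3 cub]. *)
Definition dquad (k : R) : R := dN k * (64 * ellK k ^ 2) * quad k + (64 * ellK k ^ 2) ^ 2 * (2 * k ^ 3 - k).

Definition dcubic (k : R) : R :=
  3 * (64 * ellK k ^ 2) ^ 2 * dN k * cub k + (64 * ellK k ^ 2) ^ 3 * (12 * k ^ 5 - 12 * k ^ 3 - 6 * k).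

(** Once [sn^2] and [dn^2] are written through [cn^2], this Weierstrass cubic equation is a
    polynomial identity. *)
Lemma field_u_energy (L k x : R) : 0 < k < 1 -> L <> 0 ->
  field_ux L k x ^ 2 = - (field_u L k x ^ 3 - 3 * (64 * ellK k ^ 2) ^ 2 * quad k * field_u L k x
    + (64 * ellK k ^ 2) ^ 3 * cub k) / (12 * L ^ 2).
Proof.
move=> hk L0; have [hs hd] := amp_relations L k x hk.
rewrite /field_ux /field_u /quad /cub; move: hs hd.
set s := sin _; set c := cos _; set d := ellD _ _ => hs hd.
transitivity ((2 * ellK k / L * (64 * ellK k ^ 2) * (6 * k ^ 2)) ^ 2 * (s ^ 2 * c ^ 2 * d ^ 2)); first by ring.
by rewrite hs hd; field.
Qed.

Lemma field_ux_derive (L k x : R) : 0 < k < 1 -> L <> 0 ->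
  is_derive (field_ux L k) x
    (- (field_u L k x ^ 2 - (64 * ellK k ^ 2) ^ 2 * quad k) / (8 * L ^ 2)).
Proof.
move=> hk L0; have [hs hd] := amp_relations L k x hk.
rewrite /field_ux; amp_auto_derive L k x hk.
rewrite /field_u /quad -/c; rewrite -/s -/c -/d in hs hd.
transitivity (- w ^ 2 * (64 * ellK k ^ 2) * (6 * k ^ 2)
  * (c ^ 2 * d ^ 2 - s ^ 2 * d ^ 2 - k ^ 2 * (s ^ 2 * c ^ 2))).
  by field; lra.
by rewrite hs hd /w; field.
Qed.

(** Formally the k-derivative of [field_u_energy]. It is checked on the explicit formulas, so that
    derivatives in [x] and [k] are never interchanged. *)
Lemma field_energy_variation (L k x : R) : 0 < k < 1 -> L <> 0 ->
  2 * field_ux L k x * field_vx L k x = - (3 * field_u L k x ^ 2 * field_v L k x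
    - 3 * (64 * ellK k ^ 2) ^ 2 * quad k * field_v L k x
    - 6 * dquad k * field_u L k x + dcubic k) / (12 * L ^ 2).
Proof.
move=> hk L0; have [hs hd] := amp_relations L k x hk.
rewrite /field_ux /field_vx /field_u /field_v /dquad /dcubic /quad /cub /dN.
move: hs hd.
set s := sin _; set c := cos _; set d := ellD _ _; set z := zeta _ _ _ => hs hd.
field_simplify_eq; last by repeat split; nra.
ring [hs hd].
Qed.

Lemma field_vx_derive (L k x : R) : 0 < k < 1 -> L <> 0 ->
  is_derive (field_vx L k) x (- (field_u L k x * field_v L k x - dquad k) / (4 * L ^ 2)).
Proof.
move=> hk L0; have [hs hd] := amp_relations L k x hk.
rewrite /field_vx; amp_auto_derive L k x hk.
rewrite /field_u /field_v /dquad /quad /dN -/s -/c -/d -/z; rewrite -/s -/c -/d in hs hd.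
rewrite /w; field_simplify_eq; last by repeat split; nra.
ring [hs hd].
Qed.

Lemma ellK_derive_eratio (k : R) : 0 < k < 1 ->
  is_derive ellK k (ellK k * (eratio k - (1 - k ^ 2)) / (k * (1 - k ^ 2))).
Proof.
move=> hk; apply: is_derive_value; first exact: ellK_derive.
by have K0 := ellK_pos k hk; rewrite /eratio; field; repeat split; nra.
Qed.

Lemma field_u_derive_modulus (L k x : R) : 0 < k < 1 ->
  is_derive (fun k => field_u L k x) k (field_v L k x).
Proof.
move=> hk; have da := amp_derive_modulus L k x hk; have dK := ellK_derive_eratio k hk.
rewrite /field_u; auto_derive.
  by repeat split; eexists; first [exact: da | exact: dK].
rewrite (is_derive_unique (fun k => amp L k x) _ _ da) (is_derive_unique (fun k => ellK k) _ _ dK).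
rewrite /field_v /dN; set s := sin _; set c := cos _; set d := ellD _ _; set z := zeta _ _ _.
by field; repeat split; nra.
Qed.

Lemma field_values (L k : R) : 0 < k < 1 -> L <> 0 ->
  [/\ field_u L k L = field_u L k 0, field_v L k L = field_v L k 0,
    field_ux L k 0 = 0 /\ field_ux L k L = 0 & field_vx L k 0 = 0 /\ field_vx L k L = 0].
Proof.
move=> hk L0; rewrite /field_u /field_v /field_ux /field_vx amp_0 // amp_L // zeta_0 // zeta_L //.
rewrite sin_0 cos_0 sin_PI cos_PI.
by split; try split; rewrite /=; ring.
Qed.

Lemma field_u_periodic (L k x : R) : 0 < k < 1 -> L <> 0 ->
  field_u L k (x + L) = field_u L k x.
Proof. by move=> hk L0; rewrite /field_u amp_shift // neg_cos; ring. Qed.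

(** Obtained from [k^2 cn^2 = dn^2 - (1 - k^2)] and the mean [eratio] of [dn^2]. *)
Definition mean_u (k : R) : R := 64 * ellK k ^ 2 * (3 * eratio k + k ^ 2 - 2).

Definition field_u_int (L k x : R) : R :=
  mean_u k * x - 3 * 64 * ellK k ^ 2 / (2 * ellK k / L) * zeta L k x.

Lemma field_u_int_derive (L k x : R) : 0 < k < 1 -> L <> 0 ->
  is_derive (field_u_int L k) x (field_u L k x).
Proof.
move=> hk L0; have [hs hd] := amp_relations L k x hk.
have K0 := ellK_pos k hk; have dz := zeta_derive L k x hk.
rewrite /field_u_int; auto_derive; first by eexists; exact: dz.
rewrite (is_derive_unique (fun x => zeta L k x) _ _ dz) hd /field_u /mean_u.
by field; lra.
Qed.

Lemma field_u_int_values (L k : R) : 0 < k < 1 -> L <> 0 ->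
  field_u_int L k L - field_u_int L k 0 = mean_u k * L.
Proof. by move=> hk L0; rewrite /field_u_int zeta_0 // zeta_L //; ring. Qed.

(** * Means over a period *)

(** Means are encoded by a primitive of [f - mu] with equal values at 0 and [L]. They are thus
    handled by differentiation alone, and integrals enter only at the end. *)
Definition has_mean (L : R) (f : R -> R) (mu : R) : Prop :=
  exists H : R -> R, (forall x, is_derive H x (f x - mu)) /\ H L = H 0.

(** Only the differences with the means are compared, so constants may move between a function and
    its mean. *)
Lemma has_mean_ext (L : R) (f h : R -> R) (mu nu : R) :
  has_mean L f mu -> (forall x, h x - nu = f x - mu) -> has_mean L h nu.
Proof. by move=> [H [dH e]] fh; exists H; split=> // x; rewrite fh. Qed.

Lemma has_mean_plus (L : R) (f h : R -> R) (mu nu : R) :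
  has_mean L f mu -> has_mean L h nu -> has_mean L (fun x => f x + h x) (mu + nu).
Proof.
move=> [H1 [d1 e1]] [H2 [d2 e2]]; exists (fun x => H1 x + H2 x); split; last by rewrite e1 e2.
move=> x; apply: is_derive_value; first by apply: is_derive_plus; [exact: d1 | exact: d2].
by rewrite /plus /=; ring.
Qed.

Lemma has_mean_scal (L b : R) (f : R -> R) (mu : R) :
  has_mean L f mu -> has_mean L (fun x => b * f x) (b * mu).
Proof.
move=> [H [d e]]; exists (fun x => b * H x); split; last by rewrite e.
move=> x; apply: is_derive_value; first by apply: is_derive_scal; exact: d.
by rewrite /=; ring.
Qed.

Lemma has_mean_const (L b : R) : has_mean L (fun _ => b) b.
Proof.
by exists (fun _ => 0); split=> // x; apply: is_derive_value; [exact: is_derive_const | rewrite Rminus_diag_eq].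
Qed.

Lemma has_mean_derive (L : R) (f h : R -> R) :
  (forall x, is_derive h x (f x)) -> h L = h 0 -> has_mean L f 0.
Proof. by move=> dh e; exists h; split=> // x; rewrite Rminus_0_r. Qed.

Definition dg (k : R) : R := dquad k / g k.
Definition cubic (k : R) : R := (64 * ellK k ^ 2) ^ 3 * cub k.

Lemma disc_sqr (k : R) : 0 < k < 1 -> disc k ^ 2 = quad k.
Proof. by move=> hk; apply: pow2_sqrt; rewrite /quad; nra. Qed.

Lemma disc_pos (k : R) : 0 < k < 1 -> 0 < disc k.
Proof. by move=> hk; apply: sqrt_lt_R0; nra. Qed.

Lemma g_pos (k : R) : 0 < k < 1 -> 0 < g k.
Proof.
move=> hk; have := ellK_pos k hk; have := disc_pos k hk; rewrite /g => h1 h2.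
by repeat apply: Rmult_lt_0_compat => //; lra.
Qed.

Lemma g_sqr (k : R) : 0 < k < 1 -> (64 * ellK k ^ 2) ^ 2 * quad k = g k ^ 2.
Proof. by move=> hk; rewrite /g -disc_sqr //; ring. Qed.

Lemma g_dg (k : R) : 0 < k < 1 -> dquad k = g k * dg k.
Proof. by move=> hk; have := g_pos k hk; rewrite /dg => h; field; lra. Qed.

(* [U] solves the travelling-wave equation written for the square root of the profile,
   and [V] its variation when the parameters [G] and [D] move at speeds [G'] and [D']. *)
Record wave (L G G' D D' : R) (U V Ux Vx : R -> R) : Prop := {
  wave_U : forall x, is_derive U x (Ux x);
  wave_V : forall x, is_derive V x (Vx x);
  wave_Ux : forall x, is_derive Ux x (- (U x ^ 2 - G ^ 2) / (8 * L ^ 2));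
  wave_Vx : forall x, is_derive Vx x (- (U x * V x - G * G') / (4 * L ^ 2));
  wave_energy : forall x,
    Ux x ^ 2 = - (U x ^ 3 - 3 * G ^ 2 * U x + D) / (12 * L ^ 2);
  wave_variation : forall x, Ux x * Vx x
    = - (3 * U x ^ 2 * V x - 3 * G ^ 2 * V x - 6 * (G * G') * U x + D') / (24 * L ^ 2);
  wave_values : [/\ U L = U 0, V L = V 0, Ux 0 = 0 /\ Ux L = 0 & Vx 0 = 0 /\ Vx L = 0]
}.

Lemma field_wave (L k : R) : 0 < k < 1 -> L <> 0 ->
  wave L (g k) (dg k) (cubic k) (dcubic k)
    (field_u L k) (field_v L k) (field_ux L k) (field_vx L k).
Proof.
move=> hk L0; split; last exact: field_values.
- by move=> x; exact: field_u_derive.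
- by move=> x; exact: field_v_derive.
- by move=> x; rewrite -g_sqr //; exact: field_ux_derive.
- by move=> x; rewrite -g_dg //; exact: field_vx_derive.
- by move=> x; rewrite field_u_energy // -g_sqr //; congr (- _ / _); rewrite /cubic; ring.
- move=> x; rewrite -g_sqr // -g_dg //.
  have := field_energy_variation L k x hk L0 => e.
  have -> : field_ux L k x * field_vx L k x = (2 * field_ux L k x * field_vx L k x) / 2 by field.
  by rewrite e; field.
Qed.

Ltac wave_derive w :=
  auto_derive;
  [ by repeat split; eexists; first [exact: (wave_U _ _ _ _ _ _ _ _ _ w _)
      | exact: (wave_V _ _ _ _ _ _ _ _ _ w _)
      | exact: (wave_Ux _ _ _ _ _ _ _ _ _ w _) | exact: (wave_Vx _ _ _ _ _ _ _ _ _ w _)] |];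
  rewrite ?(is_derive_unique _ _ _ (wave_U _ _ _ _ _ _ _ _ _ w _))
    ?(is_derive_unique _ _ _ (wave_V _ _ _ _ _ _ _ _ _ w _))
    ?(is_derive_unique _ _ _ (wave_Ux _ _ _ _ _ _ _ _ _ w _))
    ?(is_derive_unique _ _ _ (wave_Vx _ _ _ _ _ _ _ _ _ w _)).

Ltac wave_endpoints w :=
  let eU := fresh in let eV := fresh in let a := fresh in let b := fresh in
  let c := fresh in let d := fresh in
  case: (wave_values _ _ _ _ _ _ _ _ _ w) => eU eV [a b] [c d];
  rewrite ?eU ?eV ?a ?b ?c ?d; ring.

Lemma mean_U2 (L G G' D D' : R) (U V Ux Vx : R -> R) : L <> 0 ->
  wave L G G' D D' U V Ux Vx -> has_mean L (fun x => U x ^ 2) (G ^ 2).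
Proof.
move=> L0 w; exists (fun x => - 8 * L ^ 2 * Ux x); split; last by wave_endpoints w.
by move=> x; wave_derive w; field.
Qed.

(** By the energy identity the derivative of [U Ux] is a cubic in [U] with leading coefficient
    [- 5 / (24 L^2)]; the factor [- 24 / 5 * L^2] makes it monic. The fourth power comes likewise
    from [U^2 Ux]. *)
Lemma mean_U3 (L G G' D D' W : R) (U V Ux Vx : R -> R) : L <> 0 ->
  wave L G G' D D' U V Ux Vx -> has_mean L U W ->
  has_mean L (fun x => U x ^ 3) (9 / 5 * G ^ 2 * W - 2 / 5 * D).
Proof.
move=> L0 w mU; have m0 : has_mean L (fun x => (- 24 / 5 * L ^ 2) * (Ux x * Ux x + U x * (- (U x ^ 2 - G ^ 2) / (8 * L ^ 2)))) 0.
  apply: (has_mean_derive _ _ (fun x => (- 24 / 5 * L ^ 2) * (U x * Ux x))); last by wave_endpoints w.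
  by move=> x; wave_derive w; field.
apply: has_mean_ext (has_mean_plus _ _ _ _ _ m0 (has_mean_scal _ (9 / 5 * G ^ 2) _ _ mU)) _ => x.
have e := wave_energy _ _ _ _ _ _ _ _ _ w x.
have -> : Ux x * Ux x = Ux x ^ 2 by ring.
by rewrite e; field.
Qed.

Lemma mean_U4 (L G G' D D' W : R) (U V Ux Vx : R -> R) : L <> 0 ->
  wave L G G' D D' U V Ux Vx -> has_mean L U W ->
  has_mean L (fun x => U x ^ 4) (15 / 7 * G ^ 4 - 4 / 7 * D * W).
Proof.
move=> L0 w mU; have m0 : has_mean L (fun x => (- 24 / 7 * L ^ 2)
   * (2 * U x * Ux x ^ 2 + U x ^ 2 * (- (U x ^ 2 - G ^ 2) / (8 * L ^ 2)))) 0.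
  apply: (has_mean_derive _ _ (fun x => (- 24 / 7 * L ^ 2) * (U x ^ 2 * Ux x))); last by wave_endpoints w.
  by move=> x; wave_derive w; field.
have m2 := has_mean_scal _ (15 / 7 * G ^ 2) _ _ (mean_U2 _ _ _ _ _ _ _ _ _ L0 w).
have m1 := has_mean_scal _ (- 4 / 7 * D) _ _ mU.
apply: has_mean_ext (has_mean_plus _ _ _ _ _ m0 (has_mean_plus _ _ _ _ _ m2 m1)) _ => x.
by rewrite (wave_energy _ _ _ _ _ _ _ _ _ w x); field.
Qed.

Lemma mean_UV (L G G' D D' : R) (U V Ux Vx : R -> R) : L <> 0 ->
  wave L G G' D D' U V Ux Vx -> has_mean L (fun x => U x * V x) (G * G').
Proof.
move=> L0 w; exists (fun x => - 4 * L ^ 2 * Vx x); split; last by wave_endpoints w.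
by move=> x; wave_derive w; field.
Qed.

(* The linearized energy identity gives two exact derivatives, [(U Vx)'] and [(Ux V)'],
   from which the means of [V] and [U^2 V] are solved. *)
Lemma mean_V_U2V (L G G' D D' W : R) (U V Ux Vx : R -> R) : L <> 0 -> G <> 0 ->
  wave L G G' D D' U V Ux Vx -> has_mean L U W ->
  has_mean L V ((G * G' * W / 2 + D' / 12) / G ^ 2) /\
  has_mean L (fun x => U x ^ 2 * V x) (3 / 2 * G * G' * W - D' / 12).
Proof.
move=> L0 G0 w mU.
have m1 : has_mean L (fun x => L ^ 2 * (Ux x * Vx x + U x * (- (U x * V x - G * G') / (4 * L ^ 2)))) 0.
  apply: (has_mean_derive _ _ (fun x => L ^ 2 * (U x * Vx x))); last by wave_endpoints w.
  by move=> x; wave_derive w; field.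
have m2 : has_mean L (fun x => L ^ 2 * (Ux x * Vx x - (U x ^ 2 - G ^ 2) / (8 * L ^ 2) * V x)) 0.
  apply: (has_mean_derive _ _ (fun x => L ^ 2 * (Ux x * V x))); last by wave_endpoints w.
  by move=> x; wave_derive w; field.
split.
  have := has_mean_plus _ _ _ _ _ (has_mean_scal _ (/ G ^ 2 * - 4) _ _ m1)
   (has_mean_plus _ _ _ _ _ (has_mean_scal _ (/ G ^ 2 * 6) _ _ m2)
     (has_mean_scal _ (G' / (2 * G)) _ _ mU)).
  move=> m; apply: has_mean_ext m _ => x.
  by rewrite (wave_variation _ _ _ _ _ _ _ _ _ w x); field.
have := has_mean_plus _ _ _ _ _ (has_mean_scal _ (- 4) _ _ m1)
   (has_mean_plus _ _ _ _ _ (has_mean_scal _ 2 _ _ m2)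
     (has_mean_scal _ (3 / 2 * G * G') _ _ mU)).
move=> m; apply: has_mean_ext m _ => x.
by rewrite (wave_variation _ _ _ _ _ _ _ _ _ w x); field.
Qed.

(** The exact derivative is that of [U^2 Vx], with [Ux Vx] eliminated by the linearized energy
    identity. *)
Lemma mean_U3V (L G G' D D' W : R) (U V Ux Vx : R -> R) : L <> 0 ->
  wave L G G' D D' U V Ux Vx -> has_mean L U W ->
  has_mean L (fun x => U x ^ 3 * V x) (2 * G ^ 3 * G' - D' * W / 6).
Proof.
move=> L0 w mU.
have m0 : has_mean L (fun x => - 2 * L ^ 2 * (2 * U x * (Ux x * Vx x)
    + U x ^ 2 * (- (U x * V x - G * G') / (4 * L ^ 2)))) 0.
  apply: (has_mean_derive _ _ (fun x => - 2 * L ^ 2 * (U x ^ 2 * Vx x))); last by wave_endpoints w.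
  by move=> x; wave_derive w; field.
have := has_mean_plus _ _ _ _ _ m0 (has_mean_plus _ _ _ _ _
  (has_mean_scal _ (G ^ 2 / 2) _ _ (mean_UV _ _ _ _ _ _ _ _ _ L0 w))
  (has_mean_plus _ _ _ _ _ (has_mean_scal _ (3 / 2 * G * G') _ _ (mean_U2 _ _ _ _ _ _ _ _ _ L0 w))
     (has_mean_scal _ (- D' / 6) _ _ mU))).
move=> m; apply: has_mean_ext m _ => x.
by rewrite (wave_variation _ _ _ _ _ _ _ _ _ w x); field.
Qed.

Lemma mean_field_u (L k : R) : 0 < k < 1 -> L <> 0 -> has_mean L (field_u L k) (mean_u k).
Proof.
move=> hk L0; exists (fun x => field_u_int L k x - mean_u k * x); split.
  move=> x; have d := field_u_int_derive L k x hk L0; auto_derive; first by eexists; exact: d.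
  by rewrite (is_derive_unique (fun x => field_u_int L k x) _ _ d); ring.
by have := field_u_int_values L k hk L0; lra.
Qed.

(** * Positivity *)

(* [(pnorm, rnorm)] is the curve [(E2 / sqrt E4, E6 / E4^(3/2))] of Eisenstein series;
   [dg_norm] and [dcubic_norm] are Ramanujan's differential equations for it. *)
Definition pnorm (k : R) : R := (3 * eratio k + k ^ 2 - 2) / disc k.
Definition rnorm (k : R) : R := cub k / (2 * disc k ^ 3).
(** This is [sqrt E4] times the logarithmic k-derivative of the squared nome: the speed along the
    curve. *)
Definition lnorm (k : R) : R := 4 * disc k / (k * (1 - k ^ 2)).

Lemma lnorm_pos (k : R) : 0 < k < 1 -> 0 < lnorm k.
Proof.
move=> hk; have h := disc_pos k hk; apply: Rdiv_lt_0_compat; first lra.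
by apply: Rmult_lt_0_compat; nra.
Qed.

Lemma mean_u_norm (k : R) : 0 < k < 1 -> mean_u k = g k * pnorm k.
Proof. by move=> hk; have h := disc_pos k hk; rewrite /mean_u /pnorm /g; field; lra. Qed.

Lemma cubic_norm (k : R) : 0 < k < 1 -> cubic k = 2 * rnorm k * g k ^ 3.
Proof. by move=> hk; have h := disc_pos k hk; rewrite /cubic /rnorm /g; field; lra. Qed.

Lemma dg_norm (k : R) : 0 < k < 1 -> dg k = lnorm k * g k * (pnorm k - rnorm k) / 6.
Proof.
move=> hk; have h := disc_pos k hk; have K0 := ellK_pos k hk; have h2 := disc_sqr k hk.
apply: (Rmult_eq_reg_l (g k)); last by have := g_pos k hk; lra.
rewrite -g_dg // /lnorm /pnorm /rnorm /dquad /dN /cub /g -h2.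
transitivity (4096 * ellK k ^ 4 * (4 / (k * (1 - k ^ 2)))
   * ((3 * eratio k + k ^ 2 - 2) * disc k ^ 2 - cub k / 2) / 6); last first.
  by rewrite /cub; field; repeat split; nra.
by rewrite h2 /quad /cub; field; repeat split; nra.
Qed.

Lemma dcubic_norm (k : R) : 0 < k < 1 ->
  dcubic k = lnorm k * g k ^ 3 * (pnorm k * rnorm k - 1).
Proof.
move=> hk; have h := disc_pos k hk; have K0 := ellK_pos k hk; have h2 := disc_sqr k hk.
rewrite /lnorm /pnorm /rnorm /dcubic /dN /g.
transitivity (262144 * ellK k ^ 6 * (4 / (k * (1 - k ^ 2)))
   * ((3 * eratio k + k ^ 2 - 2) * cub k / 2 - (disc k ^ 2) ^ 2)); last first.
  by field; repeat split; nra.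
by rewrite h2 /quad /cub; field; repeat split; nra.
Qed.

(** The discriminant identity [4 quad^3 - cub^2 = 27 k^4 (1 - k^2)^2], the counterpart of
    [E4^3 - E6^2 = 1728 Delta]. *)
Lemma one_minus_rnorm_sqr (k : R) : 0 < k < 1 ->
  1 - rnorm k ^ 2 = 27 * k ^ 4 * (1 - k ^ 2) ^ 2 / (4 * disc k ^ 6).
Proof.
move=> hk; have h := disc_pos k hk; have h2 := disc_sqr k hk; rewrite /rnorm.
have -> : 1 - (cub k / (2 * disc k ^ 3)) ^ 2 = (4 * (disc k ^ 2) ^ 3 - cub k ^ 2) / (4 * disc k ^ 6).
  by field; lra.
by congr (_ / _); rewrite h2 /quad /cub; ring.
Qed.

Lemma rnorm_bounds (k : R) : 0 < k < 1 -> -1 < rnorm k < 1.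
Proof.
move=> hk; have h := disc_pos k hk; have e := one_minus_rnorm_sqr k hk.
have : 0 < 27 * k ^ 4 * (1 - k ^ 2) ^ 2 / (4 * disc k ^ 6).
  apply: Rdiv_lt_0_compat; last by apply: Rmult_lt_0_compat; [lra | exact: pow_lt].
  by repeat apply: Rmult_lt_0_compat; try apply: pow_lt; nra.
by rewrite -e => {}e; nra.
Qed.

(** The upper bound on [eratio] reduces this to [1 - k^2 / 2 <= disc k]; the squares differ by
    [3 k^4 / 4]. *)
Lemma pnorm_le1 (k : R) : 0 < k < 1 -> pnorm k <= 1.
Proof.
move=> hk; have h := disc_pos k hk; have h2 := disc_sqr k hk; have e := eratio_le k hk.
apply/Rle_div_l => //; rewrite Rmult_1_l.
suff : 1 - k ^ 2 / 2 <= disc k by lra.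
by move: h2; rewrite /quad; nra.
Qed.

(** Replacing [eratio k] by its lower bound [t] turns the numerator of the difference into a
    polynomial in [t], which factors as stated. *)
Lemma pnorm_gap (k t : R) : 0 < k < 1 -> t = sqrt (1 - k ^ 2) ->
  3 * t * (1 - t) ^ 2 * (2 * t ^ 2 + 3 * t + 2) / (2 * disc k ^ 3) <= pnorm k - rnorm k.
Proof.
move=> hk tE; have h := disc_pos k hk; have h2 := disc_sqr k hk; have e := eratio_ge k hk.
rewrite -tE in e; have t2 : t ^ 2 = 1 - k ^ 2 by rewrite tE; apply: pow2_sqrt; nra.
have kE : k ^ 2 = 1 - t ^ 2 by lra.
have -> : pnorm k - rnorm k = (2 * (3 * eratio k + k ^ 2 - 2) * disc k ^ 2 - cub k) / (2 * disc k ^ 3).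
  by rewrite /pnorm /rnorm; field; lra.
apply: Rmult_le_compat_r.
  by apply: Rlt_le; apply: Rinv_0_lt_compat; apply: Rmult_lt_0_compat; [lra | exact: pow_lt].
have -> : 3 * t * (1 - t) ^ 2 * (2 * t ^ 2 + 3 * t + 2)
   = 2 * (3 * t + k ^ 2 - 2) * disc k ^ 2 - cub k.
  rewrite h2 /quad /cub; have -> : k ^ 4 = (k ^ 2) ^ 2 by ring.
  by rewrite kE; ring.
have : 0 < disc k ^ 2 by exact: pow_lt.
nra.
Qed.

Lemma modulus_compl (k t : R) : 0 < k < 1 -> t = sqrt (1 - k ^ 2) -> 0 < t < 1 /\ k ^ 2 = 1 - t ^ 2.
Proof.
move=> hk tE; have t2 : t ^ 2 = 1 - k ^ 2 by rewrite tE; apply: pow2_sqrt; nra.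
have t0 : 0 < t by rewrite tE; apply: sqrt_lt_R0; nra.
by split; nra.
Qed.

Lemma rnorm_lt_pnorm (k : R) : 0 < k < 1 -> rnorm k < pnorm k.
Proof.
move=> hk; have h := disc_pos k hk; have gap := pnorm_gap k _ hk (Logic.eq_refl _).
have [t0 _] := modulus_compl k _ hk (Logic.eq_refl _); set t := sqrt _ in t0 gap.
suff : 0 < 3 * t * (1 - t) ^ 2 * (2 * t ^ 2 + 3 * t + 2) / (2 * disc k ^ 3) by lra.
apply: Rdiv_lt_0_compat; last by apply: Rmult_lt_0_compat; [lra | exact: pow_lt].
by repeat apply: Rmult_lt_0_compat; nra.
Qed.

Lemma dg_pos (k : R) : 0 < k < 1 -> 0 < dg k.
Proof.
move=> hk; rewrite dg_norm //; have := rnorm_lt_pnorm k hk => h.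
have h1 := lnorm_pos k hk; have h2 := g_pos k hk.
apply: Rdiv_lt_0_compat; last lra.
apply: Rmult_lt_0_compat; last lra.
exact: Rmult_lt_0_compat.
Qed.

(** The left side equals [- lnorm g^3 (1 - pnorm) (1 + rnorm)]. It yields the sign of [doffset]. *)
Lemma dcubic_bound (k : R) : 0 < k < 1 -> 6 * g k ^ 2 * dg k + dcubic k <= 0.
Proof.
move=> hk; rewrite dg_norm // dcubic_norm //.
have h1 := lnorm_pos k hk; have h2 := g_pos k hk.
have rb := rnorm_bounds k hk; have pb := pnorm_le1 k hk.
have -> : 6 * g k ^ 2 * (lnorm k * g k * (pnorm k - rnorm k) / 6)
  + lnorm k * g k ^ 3 * (pnorm k * rnorm k - 1)
  = - ((lnorm k * g k ^ 3) * ((1 - pnorm k) * (1 + rnorm k))) by field.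
have : 0 <= (lnorm k * g k ^ 3) * ((1 - pnorm k) * (1 + rnorm k)); last by lra.
apply: Rmult_le_pos; last by apply: Rmult_le_pos; lra.
by apply: Rmult_le_pos; [lra | apply: pow_le; lra].
Qed.

(* The value of [mean_variation], expanded in powers of [e = pnorm - rnorm]. *)
Lemma variation_form_pos (r e : R) : -1 < r < 1 -> 0 < e ->
  (r <= 0 /\ 2 * (1 - r ^ 2) <= 19 * e ^ 2) \/ 1 - r <= 7 * e ->
  0 < - (1 - r ^ 2) ^ 2 + 7 * (1 - r ^ 2) * (1 + r) * e + (1 + r) * (19 - 11 * r) * e ^ 2
    + (83 / 5 - 5 * r) * e ^ 3.
Proof.
move=> hr e0 hcase.
have e3 : 0 < (83 / 5 - 5 * r) * e ^ 3 by apply: Rmult_lt_0_compat; [lra | exact: pow_lt].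
have s0 : 0 < 1 - r ^ 2 by nra.
have e2 : 0 < e ^ 2 by exact: pow_lt.
(* Only the first term is negative. The quadratic term in [e] compensates it in the first case, the
   linear term in the second. *)
case: hcase => [[r0 h] | h].
  have h1 : (1 + r) * (2 * (1 - r ^ 2)) <= (1 + r) * (19 * e ^ 2) by apply: Rmult_le_compat_l; lra.
  have h2 : (1 - r ^ 2) ^ 2 <= (1 + r) * (2 * (1 - r ^ 2)).
    have -> : (1 - r ^ 2) ^ 2 = (1 + r) * ((1 - r) * (1 - r ^ 2)) by ring.
    by apply: Rmult_le_compat_l; first lra; nra.
  have h3 : (1 + r) * (19 * e ^ 2) <= (1 + r) * (19 - 11 * r) * e ^ 2.
    by rewrite Rmult_assoc; apply: Rmult_le_compat_l; first lra; nra.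
  have : 0 < 7 * (1 - r ^ 2) * (1 + r) * e by repeat apply: Rmult_lt_0_compat; lra.
  lra.
have : (1 - r ^ 2) ^ 2 <= 7 * (1 - r ^ 2) * (1 + r) * e.
  have -> : (1 - r ^ 2) ^ 2 = (1 - r ^ 2) * (1 + r) * (1 - r) by ring.
  have -> : 7 * (1 - r ^ 2) * (1 + r) * e = (1 - r ^ 2) * (1 + r) * (7 * e) by ring.
  by apply: Rmult_le_compat_l => //; apply: Rmult_le_pos; lra.
have : 0 < (1 + r) * (19 - 11 * r) * e ^ 2 by repeat apply: Rmult_lt_0_compat; lra.
lra.
Qed.

(* The two alternatives are [k'^2 <= 1/2] and [k'^2 > 1/2]. *)
Lemma norm_cases (k : R) : 0 < k < 1 ->
  (rnorm k <= 0 /\ 2 * (1 - rnorm k ^ 2) <= 19 * (pnorm k - rnorm k) ^ 2)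
  \/ 1 - rnorm k <= 7 * (pnorm k - rnorm k).
Proof.
move=> hk; have h := disc_pos k hk; have h2 := disc_sqr k hk.
have gap := pnorm_gap k _ hk (Logic.eq_refl _).
have [t01 kE] := modulus_compl k _ hk (Logic.eq_refl _); set t := sqrt _ in t01 kE gap.
have sE := one_minus_rnorm_sqr k hk; have rb := rnorm_bounds k hk.
have d3 : 0 < disc k ^ 3 by exact: pow_lt.
have k4 : k ^ 4 = (1 - t ^ 2) ^ 2 by rewrite -kE; ring.
have t2E : 1 - k ^ 2 = t ^ 2 by lra.
rewrite k4 t2E in sE.
set q := 2 * t ^ 2 + 3 * t + 2 in gap; set e0 := _ / _ in gap.
have e00 : 0 <= e0.
  by apply: Rlt_le; apply: Rdiv_lt_0_compat; [rewrite /q; repeat apply: Rmult_lt_0_compat; nra | lra].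
have cub_sign : cub k = (1 - 2 * t ^ 2) * (t ^ 2 - 2) * (t ^ 2 + 1).
  by rewrite /cub k4 kE; ring.
case: (Rle_or_lt (t ^ 2) (1 / 2)) => ht; [left | right].
  split.
    apply/Rle_div_l; first lra.
    rewrite cub_sign Rmult_0_l.
    have : 0 <= (1 - 2 * t ^ 2) * ((2 - t ^ 2) * (t ^ 2 + 1)); last by nra.
    by apply: Rmult_le_pos; nra.
  apply: (Rle_trans _ (19 * e0 ^ 2)); last by nra.
  (* Both sides share the factor [t^2 (1 - t)^2 / (4 disc^6)]. The rest follows from
     [t (1 + t) <= (1 - t) q], that is [t^2 + t^3 <= 1], which [t^2 <= 1/2] ensures. *)
  have -> : 19 * e0 ^ 2 = 171 * (t ^ 2 * (1 - t) ^ 2) * ((1 - t) * q) ^ 2 / (4 * disc k ^ 6).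
    by rewrite /e0; field; lra.
  rewrite sE.
  have -> : 2 * (27 * (1 - t ^ 2) ^ 2 * (t ^ 2) ^ 2 / (4 * disc k ^ 6))
    = 54 * (t ^ 2 * (1 - t) ^ 2) * (t * (1 + t)) ^ 2 / (4 * disc k ^ 6) by field; lra.
  apply: Rmult_le_compat_r.
    by apply: Rlt_le; apply: Rinv_0_lt_compat; apply: Rmult_lt_0_compat; [lra | exact: pow_lt].
  have a1 : t * (1 + t) <= (1 - t) * q by rewrite /q; nra.
  have a2 : (t * (1 + t)) ^ 2 <= ((1 - t) * q) ^ 2 by apply: pow_incr; nra.
  have a3 : 0 <= t ^ 2 * (1 - t) ^ 2 by apply: Rmult_le_pos; exact: pow2_ge_0.
  have a4 := pow2_ge_0 (t * (1 + t)).
  by nra.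
have r0 : 0 <= rnorm k.
  apply/Rle_div_r; first lra.
  rewrite cub_sign Rmult_0_l.
  have : 0 <= (2 * t ^ 2 - 1) * ((2 - t ^ 2) * (t ^ 2 + 1)); last by nra.
  by apply: Rmult_le_pos; nra.
apply: (Rle_trans _ (1 - rnorm k ^ 2)); first by nra.
apply: (Rle_trans _ (7 * e0)); last lra.
have -> : 7 * e0 = (t * (1 - t) ^ 2) * (42 * q * disc k ^ 3) / (4 * disc k ^ 6).
  by rewrite /e0; field; lra.
rewrite sE.
have -> : 27 * (1 - t ^ 2) ^ 2 * (t ^ 2) ^ 2 / (4 * disc k ^ 6)
  = (t * (1 - t) ^ 2) * (27 * t ^ 3 * (1 + t) ^ 2) / (4 * disc k ^ 6) by field; lra.
apply: Rmult_le_compat_r.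
  by apply: Rlt_le; apply: Rinv_0_lt_compat; apply: Rmult_lt_0_compat; [lra | exact: pow_lt].
apply: Rmult_le_compat_l; first by apply: Rmult_le_pos; [lra | exact: pow2_ge_0].
(* The minimum 3/4 of [quad] gives [disc^3 >= 9/14], hence [42 disc^3 >= 27]; then [t <= 1] and
   [(1 + t)^2 <= q] suffice. *)
have b1 : 3 / 4 <= disc k ^ 2 by rewrite h2 /quad k4 kE; nra.
have b2 : 86 / 100 <= disc k by nra.
have b3 : 9 / 14 <= disc k ^ 3.
  have -> : disc k ^ 3 = disc k ^ 2 * disc k by ring.
  by nra.
have b4 : (1 + t) ^ 2 <= q by rewrite /q; nra.
have b5 : t ^ 3 <= 1 by rewrite -(pow1 3); apply: pow_incr; lra.
have b6 := pow2_ge_0 (1 + t).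
have b7 : 27 * t ^ 3 * (1 + t) ^ 2 <= 27 * (1 + t) ^ 2 by nra.
have b8 : 42 * q * (9 / 14) <= 42 * q * disc k ^ 3 by apply: Rmult_le_compat_l; lra.
lra.
Qed.

(* [eta], [eta'], [eta_x], [B] and [B'] of the header. *)
Definition profile (L k x : R) : R := 25 / 144 * (g k + field_u L k x) ^ 2.
Definition profile_v (L k x : R) : R :=
  25 / 72 * (g k + field_u L k x) * (dg k + field_v L k x).
Definition profile_x (L k x : R) : R := 25 / 72 * (g k + field_u L k x) * field_ux L k x.
Definition offset (k : R) : R := - (25 / 864) * (2 * g k ^ 3 + cubic k).
Definition doffset (k : R) : R := - (25 / 864) * (6 * g k ^ 2 * dg k + dcubic k).

Lemma mean_variation (L k : R) : 0 < k < 1 -> L <> 0 ->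
  exists2 mu, 0 < mu &
  has_mean L (fun x => (dg k * profile L k x + doffset k) * profile_v L k x) mu.
Proof.
move=> hk L0; have w := field_wave L k hk L0; have mU := mean_field_u L k hk L0.
have G0 := g_pos k hk; have l0 := lnorm_pos k hk; have h := disc_pos k hk.
have G0' : g k <> 0 by lra.
have [mV mU2V] := mean_V_U2V _ _ _ _ _ _ _ _ _ _ L0 G0' w mU.
have mU2 := mean_U2 _ _ _ _ _ _ _ _ _ L0 w.
have mU3 := mean_U3 _ _ _ _ _ _ _ _ _ _ L0 w mU.
have mUV := mean_UV _ _ _ _ _ _ _ _ _ L0 w.
have mU3V := mean_U3V _ _ _ _ _ _ _ _ _ _ L0 w mU.
set e := pnorm k - rnorm k; set r := rnorm k.
exists ((25 / 144) ^ 2 * lnorm k ^ 2 * g k ^ 5 / 36 *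
  (- (1 - r ^ 2) ^ 2 + 7 * (1 - r ^ 2) * (1 + r) * e + (1 + r) * (19 - 11 * r) * e ^ 2
    + (83 / 5 - 5 * r) * e ^ 3)).
  apply: Rmult_lt_0_compat.
    apply: Rdiv_lt_0_compat; last lra.
    apply: Rmult_lt_0_compat; last exact: pow_lt.
    by apply: Rmult_lt_0_compat; last exact: pow_lt; lra.
  apply: variation_form_pos; first exact: rnorm_bounds.
    by have := rnorm_lt_pnorm k hk; rewrite /e /r; lra.
  exact: norm_cases.
(* With [V] the k-derivative of [U], the integrand is [a1 (G + U)^3 (G' + V) + b1 (G + U) (G' + V)];
   its monomials are summed below with their means. *)
set a1 := 2 * (25 / 144) ^ 2 * dg k; set b1 := 25 / 72 * doffset k.
have m := has_mean_plus _ _ _ _ _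
  (has_mean_const L (a1 * g k ^ 3 * dg k + b1 * g k * dg k))
  (has_mean_plus _ _ _ _ _ (has_mean_scal _ (3 * a1 * g k ^ 2 * dg k + b1 * dg k) _ _ mU)
  (has_mean_plus _ _ _ _ _ (has_mean_scal _ (3 * a1 * g k * dg k) _ _ mU2)
  (has_mean_plus _ _ _ _ _ (has_mean_scal _ (a1 * dg k) _ _ mU3)
  (has_mean_plus _ _ _ _ _ (has_mean_scal _ (a1 * g k ^ 3 + b1 * g k) _ _ mV)
  (has_mean_plus _ _ _ _ _ (has_mean_scal _ (3 * a1 * g k ^ 2 + b1) _ _ mUV)
  (has_mean_plus _ _ _ _ _ (has_mean_scal _ (3 * a1 * g k) _ _ mU2V)
    (has_mean_scal _ a1 _ _ mU3V))))))).
apply: has_mean_ext m _ => x.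
congr (_ - _).
  rewrite /profile /profile_v /a1 /b1; field.
rewrite /a1 /b1 /doffset (dcubic_norm k hk) (dg_norm k hk) (mean_u_norm k hk) (cubic_norm k hk) /e /r.
move: G0'; set G := g k; set p := pnorm k; set l := lnorm k; set rr := rnorm k => G0'.
by field.
Qed.

Lemma mean_profile_sqr (L k : R) : 0 < k < 1 -> L <> 0 ->
  exists2 mu, 0 <= mu &
  has_mean L (fun x => g k * profile L k x ^ 2 + 3 * offset k * profile L k x) mu.
Proof.
move=> hk L0; have w := field_wave L k hk L0; have mU := mean_field_u L k hk L0.
have G0 := g_pos k hk.
have mU2 := mean_U2 _ _ _ _ _ _ _ _ _ L0 w.
have mU3 := mean_U3 _ _ _ _ _ _ _ _ _ _ L0 w mU.
have mU4 := mean_U4 _ _ _ _ _ _ _ _ _ _ L0 w mU.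
set p := pnorm k; set r := rnorm k.
exists ((25 / 144) ^ 2 * g k ^ 5 * (50 / 7 + 46 / 5 * p - 26 / 5 * r - 22 / 7 * (r * p))).
  apply: Rmult_le_pos; first by apply: Rmult_le_pos; [nra | apply: pow_le; lra].
  have rb := rnorm_bounds k hk; have rp := rnorm_lt_pnorm k hk; rewrite -/p -/r in rb rp.
  (* The bracket increases with [p], so [p] may be lowered to [r]. What remains,
     [50/7 + 4 r - 22/7 r^2], vanishes at [r = -1] and is positive up to [r = 1]. *)
  have : (46 / 5 - 22 / 7 * r) * r <= (46 / 5 - 22 / 7 * r) * p.
    by apply: Rmult_le_compat_l; lra.
  nra.
set a := 25 / 144; set b := 3 * offset k.
have m := has_mean_plus _ _ _ _ _
  (has_mean_const L (a ^ 2 * g k ^ 5 + a * b * g k ^ 2))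
  (has_mean_plus _ _ _ _ _ (has_mean_scal _ (4 * a ^ 2 * g k ^ 4 + 2 * a * b * g k) _ _ mU)
  (has_mean_plus _ _ _ _ _ (has_mean_scal _ (6 * a ^ 2 * g k ^ 3 + a * b) _ _ mU2)
  (has_mean_plus _ _ _ _ _ (has_mean_scal _ (4 * a ^ 2 * g k ^ 2) _ _ mU3)
    (has_mean_scal _ (a ^ 2 * g k) _ _ mU4)))).
apply: has_mean_ext m _ => x; congr (_ - _).
  by rewrite /profile /b /a; field.
rewrite /b /a /offset (mean_u_norm k hk) (cubic_norm k hk) -/p -/r.
by field.
Qed.

(** * The periodic waves and their variation *)

Lemma g_derive (k : R) : 0 < k < 1 -> is_derive g k (dg k).
Proof.
move=> hk; have dK := ellK_derive_eratio k hk; have h := disc_pos k hk; have K0 := ellK_pos k hk.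
have h2 := disc_sqr k hk.
rewrite /g /disc; auto_derive.
  by repeat split; try nra; eexists; exact: dK.
rewrite (is_derive_unique (fun k => ellK k) _ _ dK).
have -> : k * (k * (k * (k * 1))) + - (k * (k * 1)) + 1 = k ^ 4 - k ^ 2 + 1 by ring.
rewrite -/(disc k) /dg /dquad /dN -h2 /g.
by field; repeat split; nra.
Qed.

Lemma cubic_derive (k : R) : 0 < k < 1 -> is_derive cubic k (dcubic k).
Proof.
move=> hk; have dK := ellK_derive_eratio k hk.
rewrite /cubic /cub; auto_derive; first by repeat split; eexists; exact: dK.
rewrite (is_derive_unique (fun k => ellK k) _ _ dK) /dcubic /dN /cub.
by field; repeat split; nra.
Qed.

Lemma offset_derive (k : R) : 0 < k < 1 -> is_derive offset k (doffset k).
Proof.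
move=> hk; have d1 := g_derive k hk; have d2 := cubic_derive k hk.
rewrite /offset; auto_derive; first by repeat split; eexists; first [exact: d1 | exact: d2].
rewrite (is_derive_unique (fun k => g k) _ _ d1) (is_derive_unique (fun k => cubic k) _ _ d2) /doffset.
by field.
Qed.

Lemma g_increasing (k k' : R) : 0 < k -> k < k' -> k' < 1 -> g k < g k'.
Proof.
move=> k0 kk' k1.
have hz z : Rmin k k' <= z <= Rmax k k' -> 0 < z < 1 by rewrite Rmin_left ?Rmax_right; lra.
have [z [hz' e]] := MVT_gen g k k' dg
  (fun z hz' => g_derive z (hz z (conj (Rlt_le _ _ (proj1 hz')) (Rlt_le _ _ (proj2 hz')))))
  (fun z hz' => is_derive_continuity_pt _ _ _ (g_derive z (hz z hz'))).
by have := dg_pos z (hz z hz'); nra.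
Qed.

Lemma mtildeE (L k : R) : mtilde L k = L ^ 2 - g k.
Proof. by []. Qed.

Lemma mtilde_derive (L k : R) : 0 < k < 1 -> is_derive (mtilde L) k (- dg k).
Proof.
move=> hk; apply: is_derive_value.
  by apply: (is_derive_minus (fun _ => L ^ 2) g); [exact: is_derive_const | exact: g_derive].
by rewrite /minus /plus /opp /zero /=; ring.
Qed.

(** Lets closed forms that require a nonzero [mtilde] be differentiated in [k]. *)
Lemma locally_mtilde (L k : R) : 0 < k < 1 -> 0 < mtilde L k ->
  locally k (fun k => 0 < k < 1 /\ 0 < mtilde L k).
Proof.
move=> hk hm; apply: filter_and; first exact: locally_unit.
have cm : continuous (mtilde L) k.
  by apply: ex_derive_continuous; eexists; exact: mtilde_derive.
by apply: (cm (fun y => 0 < y)); exact: open_gt.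
Qed.

Lemma phiE (L k x : R) : mtilde L k <> 0 -> phi L k x = profile L k x / mtilde L k ^ 2.
Proof.
move=> hm; rewrite /phi /profile /field_u /cn -/(amp L k x).
have -> : L ^ 2 = mtilde L k + g k by rewrite mtildeE; ring.
by field.
Qed.

(** With [m = 2 k^2 - 1] and [d = disc k], the product [(d - m)^2 (2 d + m)] is
    [2 d^3 - 3 d^2 m + m^3], and [m^3 - 3 quad m = cub]. *)
Lemma AE (L k : R) : 0 < k < 1 -> mtilde L k <> 0 -> A L k = offset k / mtilde L k ^ 3.
Proof.
move=> hk hm; have h2 := disc_sqr k hk.
rewrite /A /offset /cubic /g; set d := disc k in h2 *; set m := mtilde L k in hm *.
transitivity (- (204800 / 27) * ellK k ^ 6 / m ^ 3
  * (2 * d * d ^ 2 - 3 * d ^ 2 * (2 * k ^ 2 - 1) + (2 * k ^ 2 - 1) ^ 3)); first by field.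
have -> : 2 * d * d ^ 2 - 3 * d ^ 2 * (2 * k ^ 2 - 1) + (2 * k ^ 2 - 1) ^ 3
  = 2 * d ^ 3 + cub k.
  have -> : 2 * d ^ 3 = 2 * d * d ^ 2 by ring.
  by rewrite {2}h2 /quad /cub; ring.
by field.
Qed.

Lemma Derive_c (L k : R) : 0 < k < 1 -> 0 < mtilde L k ->
  Derive (c L) k = L ^ 2 * dg k / mtilde L k ^ 2.
Proof.
move=> hk hm; apply: is_derive_unique; have dm := mtilde_derive L k hk.
rewrite /c; auto_derive; first by repeat split; [eexists; exact: dm | lra].
by rewrite (is_derive_unique (fun k => mtilde L k) _ _ dm); field; lra.
Qed.

Lemma Derive_A (L k : R) : 0 < k < 1 -> 0 < mtilde L k ->
  Derive (A L) k = (mtilde L k * doffset k + 3 * dg k * offset k) / mtilde L k ^ 4.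
Proof.
move=> hk hm; have dm := mtilde_derive L k hk; have dB := offset_derive k hk.
apply: is_derive_unique; apply: (is_derive_ext_loc (fun k => offset k / mtilde L k ^ 3)).
  apply: filter_imp (locally_mtilde L k hk hm) => u [hu mu].
  by rewrite AE //; lra.
auto_derive.
  by repeat split; [eexists; exact: dB | eexists; exact: dm | apply: Rgt_not_eq; repeat apply: Rmult_lt_0_compat => //; lra].
rewrite (is_derive_unique (fun k => mtilde L k) _ _ dm) (is_derive_unique (fun k => offset k) _ _ dB).
by field; lra.
Qed.

Lemma dk_phiE (L k x : R) : 0 < k < 1 -> 0 < mtilde L k ->
  dk_phi L k x = (mtilde L k * profile_v L k x + 2 * dg k * profile L k x) / mtilde L k ^ 3.
Proof.
move=> hk hm; have dm := mtilde_derive L k hk; have d1 := g_derive k hk.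
have dU := field_u_derive_modulus L k x hk.
apply: is_derive_unique; apply: (is_derive_ext_loc (fun k => profile L k x / mtilde L k ^ 2)).
  apply: filter_imp (locally_mtilde L k hk hm) => u [hu mu].
  by rewrite phiE //; lra.
rewrite /profile; auto_derive.
  by repeat split; [eexists; exact: d1 | eexists; exact: dU | eexists; exact: dm | apply: Rgt_not_eq; repeat apply: Rmult_lt_0_compat => //; lra].
rewrite (is_derive_unique (fun k => mtilde L k) _ _ dm) (is_derive_unique (fun k => g k) _ _ d1)
  (is_derive_unique (fun k => field_u L k x) _ _ dU) /profile_v.
by field; lra.
Qed.

(** It suffices that [disc k > 2 k^2 - 1]; the squares differ by [3 k^2 (1 - k^2)]. The square root
    of [phi] then has no absolute value. *)
Lemma g_field_pos (L k x : R) : 0 < k < 1 -> 0 < g k + field_u L k x.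
Proof.
move=> hk; have K0 := ellK_pos k hk; have h := disc_pos k hk; have h2 := disc_sqr k hk.
have -> : g k + field_u L k x
  = 64 * ellK k ^ 2 * (disc k - (2 * k ^ 2 - 1) + 3 * k ^ 2 * cos (amp L k x) ^ 2).
  by rewrite /g /field_u; ring.
apply: Rmult_lt_0_compat; first nra.
have : 2 * k ^ 2 - 1 < disc k.
  apply: Rnot_le_lt => h3.
  have : disc k ^ 2 <= (2 * k ^ 2 - 1) ^ 2 by apply: pow_incr; lra.
  have : 0 < k ^ 2 * (1 - k ^ 2) by apply: Rmult_lt_0_compat; nra.
  by rewrite h2 /quad; nra.
have : 0 <= 3 * k ^ 2 * cos (amp L k x) ^ 2 by apply: Rmult_le_pos; nra.
lra.
Qed.

Lemma sqrt_phi (L k x : R) : 0 < k < 1 -> 0 < mtilde L k ->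
  sqrt (phi L k x) = 5 / 12 * (g k + field_u L k x) / mtilde L k.
Proof.
move=> hk hm; have h := g_field_pos L k x hk.
rewrite phiE; last lra.
have -> : profile L k x / mtilde L k ^ 2 = (5 / 12 * (g k + field_u L k x) / mtilde L k) ^ 2.
  by rewrite /profile; field; lra.
by rewrite sqrt_pow2 //; apply: Rlt_le; apply: Rdiv_lt_0_compat => //; apply: Rmult_lt_0_compat; lra.
Qed.

Definition profile_vx (L k x : R) : R :=
  25 / 72 * (field_ux L k x * (dg k + field_v L k x) + (g k + field_u L k x) * field_vx L k x).

Lemma profile_derive (L k x : R) : 0 < k < 1 ->
  is_derive (profile L k) x (profile_x L k x).
Proof.
move=> hk; have dU := field_u_derive L k x hk.
rewrite /profile; auto_derive; first by eexists; exact: dU.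
by rewrite (is_derive_unique (fun x => field_u L k x) _ _ dU) /profile_x; field.
Qed.

Lemma profile_v_derive (L k x : R) : 0 < k < 1 ->
  is_derive (profile_v L k) x (profile_vx L k x).
Proof.
move=> hk; have dU := field_u_derive L k x hk; have dV := field_v_derive L k x hk.
rewrite /profile_v; auto_derive; first by repeat split; eexists; first [exact: dU | exact: dV].
rewrite (is_derive_unique (fun x => field_u L k x) _ _ dU)
  (is_derive_unique (fun x => field_v L k x) _ _ dV) /profile_vx; field.
Qed.

(** The energy identity eliminates [field_ux^2]. There results the rescaled wave equation
    [L^2 eta_xx = G eta - eta^(3/2) + B], with [5/12 (G + U)] as the square root of [eta]. *)
Lemma profile_x_derive (L k x : R) : 0 < k < 1 -> L <> 0 ->
  is_derive (profile_x L k) x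
    ((g k * profile L k x - (5 / 12 * (g k + field_u L k x)) ^ 3 + offset k) / L ^ 2).
Proof.
move=> hk L0; have w := field_wave L k hk L0; rewrite /profile_x; wave_derive w.
transitivity (25 / 72 * (field_ux L k x ^ 2 + (g k + field_u L k x) * (- (field_u L k x ^ 2 - g k ^ 2) / (8 * L ^ 2)))).
  by field.
by rewrite (wave_energy _ _ _ _ _ _ _ _ _ w x) /profile /offset; field.
Qed.

Lemma profile_vx_derive (L k x : R) : 0 < k < 1 -> L <> 0 ->
  is_derive (profile_vx L k) x
    ((g k * profile_v L k x + dg k * profile L k x
      - 3 / 2 * (5 / 12 * (g k + field_u L k x)) * profile_v L k x + doffset k) / L ^ 2).
Proof.
move=> hk L0; have w := field_wave L k hk L0; rewrite /profile_vx; wave_derive w.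
transitivity (25 / 72 * (2 * (field_ux L k x * field_vx L k x)
  + (- (field_u L k x ^ 2 - g k ^ 2) / (8 * L ^ 2)) * (dg k + field_v L k x)
  + (g k + field_u L k x) * (- (field_u L k x * field_v L k x - g k * dg k) / (4 * L ^ 2)))).
  by field.
by rewrite (wave_variation _ _ _ _ _ _ _ _ _ w x) /profile /profile_v /doffset; field.
Qed.

Lemma is_derive_congr (f h : R -> R) (x l : R) :
  (forall t, f t = h t) -> is_derive f x l -> is_derive h x l.
Proof. by move=> fh; apply: is_derive_ext. Qed.

Lemma is_derive_comb (f h : R -> R) (x a b l l' : R) : is_derive f x l -> is_derive h x l' ->
  is_derive (fun x => a * f x + b * h x) x (a * l + b * l').
Proof.
move=> df dh; apply: is_derive_value.
  by apply: is_derive_plus; apply: is_derive_scal; [exact: df | exact: dh].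
by rewrite /plus /=.
Qed.

Lemma Derive_n_2 (f f1 : R -> R) (x l : R) : (forall x, is_derive f x (f1 x)) ->
  is_derive f1 x l -> Derive_n f 2 x = l.
Proof.
move=> d1 d2; rewrite -(is_derive_unique _ _ _ d2) /=.
by apply: Derive_ext => t; exact: is_derive_unique.
Qed.

Definition d2_profile (L k x : R) : R :=
  (g k * profile L k x - (5 / 12 * (g k + field_u L k x)) ^ 3 + offset k) / L ^ 2.

Definition d2_profile_v (L k x : R) : R :=
  (g k * profile_v L k x + dg k * profile L k x
    - 3 / 2 * (5 / 12 * (g k + field_u L k x)) * profile_v L k x + doffset k) / L ^ 2.

Lemma phi_derive (L k x : R) : 0 < k < 1 -> 0 < mtilde L k ->
  is_derive (phi L k) x (/ mtilde L k ^ 2 * profile_x L k x).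
Proof.
move=> hk hm; apply: (is_derive_congr (fun x => / mtilde L k ^ 2 * profile L k x)).
  by move=> t; rewrite phiE; [rewrite Rmult_comm | lra].
by apply: is_derive_scal; exact: profile_derive.
Qed.

Lemma Derive_n_phi (L k x : R) : 0 < k < 1 -> L <> 0 -> 0 < mtilde L k ->
  Derive_n (phi L k) 2 x = / mtilde L k ^ 2 * d2_profile L k x.
Proof.
move=> hk L0 hm; apply: Derive_n_2; first by move=> t; exact: phi_derive.
by apply: is_derive_scal; exact: profile_x_derive.
Qed.

Lemma dk_phi_derive (L k x : R) : 0 < k < 1 -> 0 < mtilde L k ->
  is_derive (dk_phi L k) x
    (/ mtilde L k ^ 2 * profile_vx L k x + 2 * dg k / mtilde L k ^ 3 * profile_x L k x).
Proof.
move=> hk hm.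
apply: (is_derive_congr (fun x => / mtilde L k ^ 2 * profile_v L k x
   + 2 * dg k / mtilde L k ^ 3 * profile L k x)).
  by move=> t; rewrite dk_phiE //; field; lra.
by apply: is_derive_comb; [exact: profile_v_derive | exact: profile_derive].
Qed.

Lemma Derive_n_dk_phi (L k x : R) : 0 < k < 1 -> L <> 0 -> 0 < mtilde L k ->
  Derive_n (dk_phi L k) 2 x
  = / mtilde L k ^ 2 * d2_profile_v L k x + 2 * dg k / mtilde L k ^ 3 * d2_profile L k x.
Proof.
move=> hk L0 hm; apply: Derive_n_2; first by move=> t; exact: dk_phi_derive.
by apply: is_derive_comb; [exact: profile_vx_derive | exact: profile_x_derive].
Qed.

(** The closed forms of both sides are compared after [L^2 = mtilde + g], which turns [c] into
    [(mtilde + g) / mtilde] and [c - 1] into [g / mtilde]. *)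
Lemma linop_dk_phi (L k x : R) : 0 < k < 1 -> L <> 0 -> 0 < mtilde L k ->
  linop L k (dk_phi L k) x
  = - (Derive (c L) k * (phi L k x - Derive_n (phi L k) 2 x) + Derive (A L) k).
Proof.
move=> hk L0 hm; rewrite /linop Derive_n_dk_phi // Derive_n_phi // sqrt_phi // dk_phiE //.
rewrite Derive_c // Derive_A // phiE; last lra.
rewrite /d2_profile /d2_profile_v /c.
set m := mtilde L k in hm *; have mE : L ^ 2 = m + g k by rewrite /m mtildeE; ring.
have pE : profile L k x = (5 / 12 * (g k + field_u L k x)) ^ 2 by rewrite /profile; field.
move: pE; set p := 5 / 12 * _; set eta := profile L k x; set nu := profile_v L k x => pE.
have m0 : m + g k <> 0 by rewrite -mE; exact: pow_nonzero.
rewrite mE pE; field; lra.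
Qed.

Lemma profile_values (L k : R) : 0 < k < 1 -> L <> 0 ->
  [/\ profile L k L = profile L k 0, profile_v L k L = profile_v L k 0,
    profile_x L k L = profile_x L k 0 & profile_vx L k L = profile_vx L k 0].
Proof.
move=> hk L0; have [eU eV [a b] [c d]] := field_values L k hk L0.
by rewrite /profile /profile_v /profile_x /profile_vx eU eV a b c d.
Qed.

(** The subtracted term is the pointwise nonnegative part of the density. The rest is, up to exact
    derivatives, a combination of the two means computed for the profile. *)
Lemma density_mean (L k : R) : 0 < k < 1 -> L <> 0 -> 0 < mtilde L k ->
  exists2 mu, 0 < mu & has_mean L (fun x =>
    (Derive (c L) k * (phi L k x - Derive_n (phi L k) 2 x) + Derive (A L) k) * dk_phi L k x
    - / mtilde L k ^ 7 * (4 * mtilde L k * dg k * profile L k x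
         * (dg k * profile L k x + doffset k)
       + 2 * dg k ^ 2 * L ^ 2 * profile_x L k x ^ 2)) mu.
Proof.
move=> hk L0 hm.
have [mu1 mu10 m1] := mean_variation L k hk L0.
have [mu2 mu20 m2] := mean_profile_sqr L k hk L0.
have [e1 e2 e3 e4] := profile_values L k hk L0.
(* Symmetry of the second derivative. By the two profile equations, the mean of
   [(eta^(3/2) + 2 B) eta'] is that of [2 eta (G' eta + B')]. *)
have m3 : has_mean L (fun x => profile L k x * d2_profile_v L k x
    - d2_profile L k x * profile_v L k x) 0.
  apply: (has_mean_derive _ _ (fun x => profile L k x * profile_vx L k x - profile_x L k x * profile_v L k x));
    last by rewrite e1 e2 e3 e4.
  move=> x; apply: is_derive_value.
    apply: is_derive_minus; apply: is_derive_mult => //;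
      try first [exact: profile_derive | exact: profile_vx_derive | exact: profile_x_derive | exact: profile_v_derive];
      exact: Rmult_comm.
  by rewrite /minus /plus /opp /mult /= /d2_profile_v /d2_profile; field.
(* Integration by parts of [eta eta_xx]: it trades the mean of [eta^(5/2)] for that of
   [L^2 eta_x^2 + G eta^2 + B eta]. *)
have m4 : has_mean L (fun x => profile_x L k x ^ 2 + profile L k x * d2_profile L k x) 0.
  apply: (has_mean_derive _ _ (fun x => profile L k x * profile_x L k x)); last by rewrite e1 e3.
  move=> x; apply: is_derive_value.
    apply: is_derive_mult => //; try first [exact: profile_derive | exact: profile_x_derive]; exact: Rmult_comm.
  by rewrite /plus /mult /= /d2_profile; field.
have m7 : 0 < / mtilde L k ^ 7 by apply: Rinv_0_lt_compat; exact: pow_lt.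
have g0 := dg_pos k hk.
exists (/ mtilde L k ^ 7 * (mtilde L k ^ 2 * mu1 + 2 * dg k ^ 2 * mu2)).
  apply: Rmult_lt_0_compat => //.
  have : 0 < mtilde L k ^ 2 * mu1 by apply: Rmult_lt_0_compat => //; exact: pow_lt.
  have : 0 <= 2 * dg k ^ 2 * mu2 by apply: Rmult_le_pos => //; nra.
  lra.
have m := has_mean_scal _ (/ mtilde L k ^ 7) _ _
  (has_mean_plus _ _ _ _ _ (has_mean_scal _ (mtilde L k ^ 2) _ _ m1)
  (has_mean_plus _ _ _ _ _ (has_mean_scal _ (2 * dg k ^ 2) _ _ m2)
  (has_mean_plus _ _ _ _ _ (has_mean_scal _ (- 2 * mtilde L k * dg k * L ^ 2) _ _ m3)
    (has_mean_scal _ (- 2 * dg k ^ 2 * L ^ 2) _ _ m4)))).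
apply: has_mean_ext m _ => x; congr (_ - _); last by field; lra.
rewrite Derive_n_phi // dk_phiE // Derive_c // Derive_A // phiE; last lra.
rewrite /d2_profile /d2_profile_v.
set m := mtilde L k in hm *; have mE : L ^ 2 = m + g k by rewrite /m mtildeE; ring.
have pE : profile L k x = (5 / 12 * (g k + field_u L k x)) ^ 2 by rewrite /profile; field.
move: pE; set p := 5 / 12 * _; set eta := profile L k x; set nu := profile_v L k x => pE.
have m0 : m + g k <> 0 by rewrite -mE; exact: pow_nonzero.
rewrite mE pE; field; lra.
Qed.

(** * Smoothness and periodicity of the waves *)

Lemma ex_derive_n_closed (P : (R -> R) -> Prop) (f : R -> R) :
  (forall f, P f -> exists2 f', P f' & forall x, is_derive f x (f' x)) ->
  P f -> forall n x, ex_derive_n f n x.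
Proof.
move=> HP Pf.
have D n : exists2 h, P h & forall x, Derive_n f n x = h x.
  elim: n => [|n [h Ph fh]]; first by exists f.
  have [h' Ph' dh] := HP h Ph; exists h' => // x /=.
  by rewrite (Derive_ext _ h) //; exact: is_derive_unique.
case=> [|n] x //=; have [h Ph fh] := D n; have [h' _ dh] := HP h Ph.
by apply: (ex_derive_ext h) => //; exists (h' x).
Qed.

(** Polynomials in sn, cn and dn: a class stable under differentiation, hence made of smooth
    functions. *)
Inductive jacobi_poly (L k : R) : (R -> R) -> Prop :=
| jacobi_const b : jacobi_poly L k (fun _ => b)
| jacobi_sn : jacobi_poly L k (fun x => sin (amp L k x))
| jacobi_cn : jacobi_poly L k (fun x => cos (amp L k x))
| jacobi_dn : jacobi_poly L k (fun x => ellD k (amp L k x))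
| jacobi_plus f h : jacobi_poly L k f -> jacobi_poly L k h -> jacobi_poly L k (fun x => f x + h x)
| jacobi_mult f h : jacobi_poly L k f -> jacobi_poly L k h -> jacobi_poly L k (fun x => f x * h x).

Lemma jacobi_poly_derive (L k : R) (f : R -> R) : 0 < k < 1 -> jacobi_poly L k f ->
  exists2 f', jacobi_poly L k f' & forall x, is_derive f x (f' x).
Proof.
move=> hk; elim=> [b||||f1 f2 p1 [f1' p1' d1] p2 [f2' p2' d2]|f1 f2 p1 [f1' p1' d1] p2 [f2' p2' d2]].
- by exists (fun _ => 0); [exact: jacobi_const | move=> x; exact: is_derive_const].
- eexists; last by move=> x; exact: sin_amp_derive.
  by repeat first [apply: jacobi_mult | exact: jacobi_const | exact: jacobi_cn | exact: jacobi_dn].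
- eexists; last by move=> x; exact: cos_amp_derive.
  by repeat first [exact: jacobi_const | exact: jacobi_sn | exact: jacobi_dn | apply: jacobi_mult].
- eexists; last by move=> x; exact: ellD_amp_derive.
  by repeat first [exact: jacobi_const | exact: jacobi_sn | exact: jacobi_cn | apply: jacobi_mult].
- exists (fun x => f1' x + f2' x); first exact: jacobi_plus.
  by move=> x; apply: is_derive_plus.
- exists (fun x => f1' x * f2 x + f1 x * f2' x).
    by apply: jacobi_plus; apply: jacobi_mult.
  by move=> x; apply: is_derive_mult => // u v; exact: Rmult_comm.
Qed.

Lemma phi_smooth (L k : R) : 0 < k < 1 -> L <> 0 -> 0 < mtilde L k ->
  (forall n x, ex_derive_n (phi L k) n x) /\ (forall x, phi L k (x + L) = phi L k x).
Proof.
move=> hk L0 hm; split; last first.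
  by move=> x; rewrite !phiE; [rewrite /profile field_u_periodic | lra | lra].
pose b := 64 * ellK k ^ 2.
pose h x := g k + - b * (2 * k ^ 2 - 1) + b * (3 * k ^ 2) * (cos (amp L k x) * cos (amp L k x)).
have ph : jacobi_poly L k (fun x => 25 / 144 / mtilde L k ^ 2 * (h x * h x)).
  by repeat first [exact: jacobi_const | exact: jacobi_cn | apply: jacobi_plus | apply: jacobi_mult].
move=> n x; apply: (ex_derive_n_ext (fun x => 25 / 144 / mtilde L k ^ 2 * (h x * h x))).
  move=> t; rewrite phiE; last lra.
  by rewrite /profile /field_u /h /b; field; lra.
by apply: (ex_derive_n_closed (jacobi_poly L k)) => // f; exact: jacobi_poly_derive.
Qed.

(** * Lebesgue integrals of continuous functions *)

Lemma slope_cvg (F : R -> R) (x l : R) : derivable_pt_lim F x l ->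
  ((fun h : R => @GRing.scale _ R^o (GRing.inv h) (F (GRing.add h x) - F x))
    @ (dnbhs (0 : R)) --> (l : R^o))%classic.
Proof.
move=> Fl.
set s := fun h : R => _.
(* Giving the quotient the value [l] at 0 turns its convergence into continuity at 0. *)
pose s' h := if (Req_EM_T h 0) then l else s h.
have s0 : s' 0 = l by rewrite /s'; case: Req_EM_T.
have sN h : h <> 0 -> s' h = s h by rewrite /s'; case: Req_EM_T.
have : continuity_pt s' 0.
  move=> e e0; have [d dP] := Fl _ e0.
  exists d; split; first exact: cond_pos.
  move=> h [[_ h0] hd]; rewrite s0 sN; last by move=> h1; case: h0.
  have -> : s h = (F (x + h) - F x) / h.
    by rewrite /s (addrC h x); exact: Rmult_comm.
  rewrite /= /Rdist Rminus_0_r in hd.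
  by apply: dP => // h1; case: h0.
move/continuity_pt_cvg'; rewrite s0 => H.
apply: cvg_trans H; apply: near_eq_cvg; near=> h.
have h0 : is_true (h != (0 : R)) by near: h; exact: nbhs_dnbhs_neq.
by rewrite sN //; exact/eqP.
Unshelve. all: by end_near.
Qed.

Lemma intL_antiderivative (L : R) (f F : R -> R) : 0 < L -> (forall x, continuity_pt f x) ->
  (forall x, is_derive F x (f x)) -> intL L f = F L - F 0.
Proof.
move=> /RltP L0 cf dF.
have dF' x : derivable_pt_lim F x (f x) by apply/is_derive_Reals.
have cF x : continuity_pt F x := is_derive_continuity_pt F x (f x) (dF x).
rewrite /intL /Rintegral (@continuous_FTC2 _ f F) //.
- apply: continuous_subspaceT => x; exact/continuity_pt_cvg.
- split.
  + move=> x _; have := slope_cvg _ _ _ (dF' x).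
    (* Derivability is a directional derivative along 1, so the increment [h] must appear as [h]
       times 1. *)
    have -> : (fun h : R => @GRing.scale _ R^o (GRing.inv h) (F (GRing.add h x) - F x))
      = (fun h : R => @GRing.scale _ R^o (GRing.inv h)
          (F (GRing.add (@GRing.scale _ R^o h 1) x) - F x)).
      apply/funext => h; have -> // : @GRing.scale _ R^o h 1 = h by exact: mulr1.
    exact: cvgP.
  + apply: cvg_at_right_filter; exact/continuity_pt_cvg.
  + apply: cvg_at_left_filter; exact/continuity_pt_cvg.
- by move=> x _; apply/cvg_lim => //; exact: slope_cvg.
Qed.

Lemma intL_has_mean (L : R) (f : R -> R) (mu : R) : 0 < L ->
  (forall x, continuity_pt f x) -> has_mean L f mu -> intL L f = mu * L.
Proof.
move=> L0 cf [H [dH e]].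
rewrite (intL_antiderivative L f (fun x => H x + mu * x)) //; first by rewrite e; ring.
move=> x; apply: is_derive_value; first by apply: is_derive_plus; [exact: dH | apply: is_derive_scal; exact: is_derive_id].
by rewrite /plus /one /=; ring.
Qed.

(** Integration by parts against a test function; the boundary terms cancel as [f psi] agrees at 0
    and [L]. *)
Lemma H1per_C1 (L : R) (f f' : R -> R) : 0 < L -> (forall x, is_derive f x (f' x)) ->
  (forall x, continuity_pt f' x) -> f L = f 0 -> H1per L f f'.
Proof.
move=> L0 df cf' fL; have cf x := is_derive_continuity_pt f x (f' x) (df x).
split; [exact: cont_L2 | exact: cont_L2 | move=> psi spsi].
have dpsi x : is_derive psi x (Derive psi x) := Derive_correct psi x (proj1 spsi (S O) x).
have cpsi := smooth_cont L psi spsi.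
have cpsi' := smooth_cont L _ (smooth_Derive L psi spsi).
have psiL : psi L = psi 0 by rewrite -(proj2 spsi 0) Rplus_0_l.
have I1 : integrable_per L (fun x => f x * Derive psi x).
  by apply: cont_int => x; exact: continuity_pt_mult.
have I2 : integrable_per L (fun x => f' x * psi x).
  by apply: cont_int => x; exact: continuity_pt_mult.
suff : intL L (fun x => f x * Derive psi x + f' x * psi x) = 0.
  by rewrite intLD // /L2inner => h; lra.
rewrite (intL_antiderivative L _ (fun x => f x * psi x)) //; first by rewrite fL psiL; ring.
  by move=> x; apply: continuity_pt_plus; exact: continuity_pt_mult.
move=> x; apply: is_derive_value.
  by apply: is_derive_mult; [exact: df | exact: dpsi | move=> u v; exact: Rmult_comm].
by rewrite /plus /mult /=; ring.
Qed.

Theorem lemma5p3 (L kL k : R) (hL : 4 * PI < L)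
    (hkL : 0 < kL < 1) (hgkL : g kL = L ^ 2) (hk : 0 < k < kL) :
  let Phi := pairing L (linop L k (dk_phi L k)) (dk_phi L k) in
  Phi = - L2inner L (dM_phi L k) (dk_phi L k) /\
  - L2inner L (dM_phi L k) (dk_phi L k) < 0.
Proof.
have hk1 : 0 < k < 1 by lra.
have Lpos : 0 < L by have := PI_RGT_0; lra.
have L0 : L <> 0 by lra.
(* Since [g] increases, [g k < g kL = L^2]. *)
have hm : 0 < mtilde L k.
  by rewrite mtildeE -hgkL; have := g_increasing k kL; lra.
have smooth : smooth_per L (phi L k) := phi_smooth L k hk1 L0 hm.
pose dM x := Derive (c L) k * (phi L k x - Derive_n (phi L k) 2 x) + Derive (A L) k.
have dMP : is_L2_derivative L (M L k) (phi L k) (Derive (phi L k)) dM.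
  exact: M_is_L2_derivative.
(* [dM_phi] is known only through its defining property, for which [dM] is a witness. *)
have dMphiP : is_L2_derivative L (M L k) (phi L k) (Derive (phi L k)) (dM_phi L k).
  by apply: epsilon_spec; exists dM.
have cP x := is_derive_continuity_pt _ _ _ (profile_derive L k x hk1).
have cPv x := is_derive_continuity_pt _ _ _ (profile_v_derive L k x hk1).
have cPx x := is_derive_continuity_pt _ _ _ (profile_x_derive L k x hk1 L0).
have cPvx x := is_derive_continuity_pt _ _ _ (profile_vx_derive L k x hk1 L0).
have cdk x := is_derive_continuity_pt _ _ _ (dk_phi_derive L k x hk1 hm).
have [eP ePv ePx ePvx] := profile_values L k hk1 L0.
have Hdk : H1per L (dk_phi L k) (fun x =>
    / mtilde L k ^ 2 * profile_vx L k x + 2 * dg k / mtilde L k ^ 3 * profile_x L k x).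
  apply: H1per_C1 => //.
  - by move=> x; exact: dk_phi_derive.
  - move=> x; apply: continuity_pt_plus; apply: continuity_pt_mult => //;
      exact: continuity_pt_const.
  - by rewrite !dk_phiE // eP ePv.
(* Two representatives of the derivative agree when tested against an element of H^1_per, here
   [dk_phi]. *)
have -> : L2inner L (dM_phi L k) (dk_phi L k) = L2inner L dM (dk_phi L k).
  exact: L2_derivative_unique dMphiP dMP Hdk.
have cdM x : continuity_pt dM x.
  apply: continuity_pt_plus; last exact: continuity_pt_const.
  apply: continuity_pt_mult; first exact: continuity_pt_const.
  apply: continuity_pt_minus; first exact: smooth_cont L _ smooth x.
  exact: smooth_cont L _ (smooth_Derive L _ (smooth_Derive L _ smooth)) x.
have cdens x : continuity_pt (fun x => dM x * dk_phi L k x) x by exact: continuity_pt_mult.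
split.
  have -> : - L2inner L dM (dk_phi L k) = -1 * L2inner L dM (dk_phi L k) by ring.
  rewrite /pairing /L2inner -intLZ; last exact: cont_int.
  by apply: intL_ext => x; rewrite linop_dk_phi // -/(dM x); ring.
(* The pointwise nonnegative part of the density, thanks to [dg_pos] and [dcubic_bound]; the
   remainder has positive mean. *)
pose nn x := / mtilde L k ^ 7 * (4 * mtilde L k * dg k * profile L k x
    * (dg k * profile L k x + doffset k) + 2 * dg k ^ 2 * L ^ 2 * profile_x L k x ^ 2).
have [mu mu0 mm] : exists2 mu, 0 < mu &
  has_mean L (fun x => dM x * dk_phi L k x - nn x) mu by exact: density_mean.
have dgp := dg_pos k hk1.
have nn0 x : 0 <= nn x.
  have p0 : 0 <= profile L k x by rewrite /profile; have := pow2_ge_0 (g k + field_u L k x); lra.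
  have b0 : 0 <= doffset k by rewrite /doffset; have := dcubic_bound k hk1; lra.
  apply: Rmult_le_pos; first by apply/Rlt_le/Rinv_0_lt_compat; exact: pow_lt.
  apply: Rplus_le_le_0_compat; last first.
    apply: Rmult_le_pos; last exact: pow2_ge_0.
    apply: Rmult_le_pos; last exact: pow2_ge_0.
    by apply: Rmult_le_pos; [lra | exact: pow2_ge_0].
  apply: Rmult_le_pos; last by apply: Rplus_le_le_0_compat => //; apply: Rmult_le_pos; lra.
  by apply: Rmult_le_pos => //; apply: Rmult_le_pos; lra.
have cnn x : continuity_pt nn x.
  have : ex_derive nn x.
    rewrite /nn; auto_derive; repeat split; eexists;
      first [exact: profile_derive | exact: profile_x_derive].
  by move=> [l dl]; exact: is_derive_continuity_pt dl.
have cdiff x : continuity_pt (fun x => dM x * dk_phi L k x - nn x) x by exact: continuity_pt_minus.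
suff : 0 < L2inner L dM (dk_phi L k) by lra.
have -> : L2inner L dM (dk_phi L k)
    = intL L (fun x => nn x + (dM x * dk_phi L k x - nn x)).
  by apply: intL_ext => x; ring.
rewrite intLD; try exact: cont_int.
rewrite (intL_has_mean _ _ _ Lpos cdiff mm).
have := intL_ge0 L nn nn0; have := Rmult_lt_0_compat _ _ mu0 Lpos; lra.
Qed.
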